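(* A control $\bar z\in\mathbb{Z}_{\mathrm{ad}}$ is the optimal control of the fractional optimal control problem (minimize $J(u,z)$ over $(u,z)\in\tilde H^s(\Omega)\times\mathbb{Z}_{\mathrm{ad}}$ subject to $u=\mathbf{S}z$) if and only if $$(\bar p+\alpha\bar z,\,z-\bar z)_{L^2(\Omega)}\ge 0\qquad\text{for every } z\in\mathbb{Z}_{\mathrm{ad}},$$ where $\bar p=\bar p(\bar z)\in\tilde H^s(\Omega)$ is the solution of $\mathcal{A}(v,\bar p)=\langle\bar u-u_d,v\rangle$ for all $v\in\tilde H^s(\Omega)$, with $\bar u=\mathbf{S}\bar z$.
   Context: Let $n\ge 1$, let $\Omega\subset\mathbb{R}^n$ be a bounded open domain with Lipschitz boundary satisfying the exterior ball condition, and let $s\in(0,1)$. The parameters $\alpha>0$ and $a,b\in\mathbb{R}$ with $a<b$ are fixed, $f\in H^{-s}(\Omega)$ is fixed, and $u_d\in L^2(\Omega)$ is the desired state. $\tilde H^s(\Omega)$ is the closure of $C_0^\infty(\Omega)$ in $H^s(\mathbb{R}^n)$ (its elements are extended by zero outside $\Omega$); $H^{-s}(\Omega)$ is its dual and $\langle\cdot,\cdot\rangle$ the duality pairing. The bilinear form is $$\mathcal{A}(v,w)=\frac{C(n,s)}{2}\iint_{\mathbb{R}^n\times\mathbb{R}^n}\frac{(v(x)-v(y))(w(x)-w(y))}{|x-y|^{n+2s}}\,dx\,dy,\qquad C(n,s)=\frac{2^{2s}s\,\Gamma(s+\frac n2)}{\pi^{n/2}\Gamma(1-s)}.$$ The control-to-state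 map $\mathbf{S}:L^2(\Omega)\to\tilde H^s(\Omega)$ sends $z$ to the unique $u=\mathbf{S}z\in\tilde H^s(\Omega)$ with $\mathcal{A}(u,v)=\langle f+z,v\rangle$ for all $v\in\tilde H^s(\Omega)$ (the weak form of $(-\Delta)^su=f+z$ in $\Omega$, $u=0$ in $\mathbb{R}^n\setminus\overline\Omega$). The cost functional is $J(u,z)=\frac12\|u-u_d\|_{L^2(\Omega)}^2+\frac\alpha2\|z\|_{L^2(\Omega)}^2$ and $\mathbb{Z}_{\mathrm{ad}}=\{w\in L^2(\Omega): a\le w(x)\le b\text{ for a.e. }x\in\Omega\}$. The optimal control is the $\bar z\in\mathbb{Z}_{\mathrm{ad}}$ such that $J(\mathbf{S}\bar z,\bar z)\le J(\mathbf{S}z,z)$ for all $z\in\mathbb{Z}_{\mathrm{ad}}$. *)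

(* Defs.v *)
From HB Require Import structures.
From mathcomp Require Import all_boot all_order all_algebra.
From mathcomp Require Import all_classical all_reals all_analysis.

Set Implicit Arguments.
Unset Strict Implicit.
Unset Printing Implicit Defensive.
Import Order.TTheory GRing.Theory Num.Theory.
Import numFieldNormedType.Exports.
Local Open Scope classical_set_scope.
Local Open Scope ring_scope.

Section euclidean_measure.
Variable R : realType.

Definition rV_coord n (i : 'I_n) (x : 'rV[R]_n) : measurableTypeR R :=
  x ord0 i.

Definition rV_display : measure_display.
Proof. exact: default_measure_display. Qed.

(* The sigma-algebra generated by the coordinates is the Borel sigma-algebra
   of R^n. *)
Section rV_measurable.
Variable n : nat.

Let rV_set0 : g_sigma_preimage (@rV_coord n) set0.
Proof. exact: sigma_algebra0. Qed.

Let rV_setC A :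
  g_sigma_preimage (@rV_coord n) A -> g_sigma_preimage (@rV_coord n) (~` A).
Proof. exact: sigma_algebraC. Qed.

Let rV_bigcup (F : _^nat) :
  (forall i, g_sigma_preimage (@rV_coord n) (F i)) ->
  g_sigma_preimage (@rV_coord n) (\bigcup_i (F i)).
Proof. exact: sigma_algebra_bigcup. Qed.

HB.instance Definition _ := @isMeasurable.Build rV_display 'rV[R]_n
  (g_sigma_preimage (@rV_coord n)) rV_set0 rV_setC rV_bigcup.

End rV_measurable.

Definition rV_cons n (p : measurableTypeR R * 'rV[R]_n) : 'rV[R]_n.+1 :=
  \row_i oapp (fun j => p.2 ord0 j) (p.1 : R) (unlift ord0 i).

(* Lebesgue measure on R^n, restricted to the Borel sets. *)
Fixpoint lebesgue_rV n : set 'rV[R]_n -> \bar R :=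
  if n is m.+1 then
    fun A => (lebesgue_measure \x @lebesgue_rV m)%E (@rV_cons m @^-1` A)
  else dirac (0 : 'rV[R]_0).

Lemma measurable_rV_coord n (i : 'I_n) : measurable_fun setT (@rV_coord n i).
Proof.
move=> _ Y mY; rewrite setTI; apply: sub_sigma_algebra => /=.
rewrite -bigcup_seq/=; exists i => /=; first by rewrite mem_index_enum.
by exists Y => //; rewrite setTI.
Qed.

Lemma measurable_fun_rVP d (T : measurableType d) n (f : T -> 'rV[R]_n) :
  (forall i, measurable_fun setT (@rV_coord n i \o f)) -> measurable_fun setT f.
Proof.
move=> mf _ A mA; rewrite setTI; move: A mA.
pose G : set (set 'rV[R]_n) := [set A | measurable (f @^-1` A)].
suff sG : g_sigma_preimage (@rV_coord n) `<=` G.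
  by move=> A; apply: (sG A).
apply: smallest_sub.
  split => [|A GA|F GF].
  - by rewrite /G/= preimage_set0.
  - by rewrite /G/= setTD preimage_setC; apply: measurableC; exact: GA.
  - rewrite /G/= preimage_bigcup.
    by apply: bigcup_measurable => k _; exact: GF.
rewrite -bigcup_seq/=; apply: bigcup_sub => i _ A [B mB <-].
rewrite /G/= setTI -comp_preimage -[X in measurable X]setTI.
exact: mf.
Qed.

Lemma measurable_rV_cons n : measurable_fun setT (@rV_cons n).
Proof.
apply: measurable_fun_rVP => i.
case: (unliftP ord0 i) => [j ->|->].
- rewrite (_ : _ \o _ = @rV_coord n j \o snd).
    by apply: measurableT_comp => //; exact: measurable_rV_coord.
  by apply/funext => p; rewrite /rV_coord/= mxE liftK.
- rewrite (_ : _ \o _ = fst)//.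
  by apply/funext => p; rewrite /rV_coord/= mxE unlift_none.
Qed.

Definition rV_uncons n (x : 'rV[R]_n.+1) : measurableTypeR R * 'rV[R]_n :=
  (x ord0 ord0, \row_j x ord0 (lift ord0 j)).

Lemma rV_consK n : cancel (@rV_cons n) (@rV_uncons n).
Proof.
move=> [a v]; congr pair; first by rewrite mxE unlift_none.
by apply/rowP => j; rewrite !mxE liftK.
Qed.

Lemma rV_unconsK n : cancel (@rV_uncons n) (@rV_cons n).
Proof.
move=> x; apply/rowP => i; rewrite mxE.
by case: (unliftP ord0 i) => [j ->|->]; rewrite ?liftK ?unlift_none /= ?mxE.
Qed.

Lemma measurable_rV_uncons n : measurable_fun setT (@rV_uncons n).
Proof.
apply: measurable_fun_pair; first exact: measurable_rV_coord.
apply: measurable_fun_rVP => i.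
rewrite (_ : _ \o _ = @rV_coord n.+1 (lift ord0 i)).
  exact: measurable_rV_coord.
by apply/funext => x; rewrite /rV_coord/= mxE.
Qed.

Section sigma_finite_measureP.
Context d (T : measurableType d) (p : {measure set T -> \bar R}).
Hypothesis sp : sigma_finite setT p.

Let q : set T -> \bar R := p.

HB.instance Definition _ := Measure.on q.
HB.instance Definition _ := Measure_isSigmaFinite.Build _ _ _ q sp.

Lemma sigma_finite_measureP :
  exists m : {sigma_finite_measure set T -> \bar R}, m = p :> (set T -> \bar R).
Proof. by exists q. Qed.

End sigma_finite_measureP.

Lemma lebesgue_rV_sigma_finite n :
  exists m : {sigma_finite_measure set 'rV[R]_n -> \bar R},
    m = @lebesgue_rV n :> (set 'rV[R]_n -> \bar R).
Proof.
elim: n => [|n [m mE]].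
  by exists (dirac (0 : 'rV[R]_0)).
pose pf : {measure set 'rV[R]_n.+1 -> \bar R} :=
  pushforward (lebesgue_measure \x m)%E (@rV_cons n).
pose p := pf (@measurable_rV_cons n).
have pE : p = @lebesgue_rV n.+1 :> (set 'rV[R]_n.+1 -> \bar R).
  by rewrite /= -mE.
have sp : sigma_finite setT p.
  have /sigma_finiteP[F [TF ndF Foo]] := sigma_finiteT (@lebesgue_measure R).
  have /sigma_finiteP[G [TG ndG Goo]] := sigma_finiteT m.
  exists (fun k => @rV_uncons n @^-1` (F k `*` G k)).
    rewrite -preimage_bigcup (_ : \bigcup_k _ = setT) ?preimage_setT//.
    rewrite -subTset => -[x y] _.
    have [i _ Fix] : (\bigcup_k F k) x by rewrite -TF.
    have [j _ Gjy] : (\bigcup_k G k) y by rewrite -TG.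
    exists (maxn i j) => //; split.
      by move: x Fix; exact/subsetPset/ndF/leq_maxl.
    by move: y Gjy; exact/subsetPset/ndG/leq_maxr.
  move=> k; have [[mF Fk] [mG Gk]] := (Foo k, Goo k); split.
    rewrite -[X in measurable X]setTI; apply: measurable_rV_uncons => //.
    exact: measurableX.
  have -> : p (@rV_uncons n @^-1` (F k `*` G k)) =
      (lebesgue_measure \x m)%E (F k `*` G k).
    congr ((lebesgue_measure \x m)%E _).
    by rewrite -comp_preimage (_ : _ \o _ = id)//; apply/funext; exact: rV_consK.
  by rewrite product_measure1E// lte_mul_pinfty// ge0_fin_numE.
by have [q qE] := sigma_finite_measureP sp; exists q; rewrite qE.
Qed.

Let lebesgue_rV0 n : @lebesgue_rV n set0 = 0%E.
Proof. by have [m <-] := lebesgue_rV_sigma_finite n; exact: measure0. Qed.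

Let lebesgue_rV_ge0 n A : (0 <= @lebesgue_rV n A)%E.
Proof. by have [m <-] := lebesgue_rV_sigma_finite n; exact: measure_ge0. Qed.

Let lebesgue_rV_sigma_additive n : semi_sigma_additive (@lebesgue_rV n).
Proof.
by have [m <-] := lebesgue_rV_sigma_finite n;
  exact: measure_semi_sigma_additive.
Qed.

HB.instance Definition _ n := isMeasure.Build _ _ _ (@lebesgue_rV n)
  (@lebesgue_rV0 n) (@lebesgue_rV_ge0 n) (@lebesgue_rV_sigma_additive n).

Let lebesgue_rV_sigma_finiteT n : sigma_finite setT (@lebesgue_rV n).
Proof. by have [m <-] := lebesgue_rV_sigma_finite n; exact: sigma_finiteT. Qed.

HB.instance Definition _ n := Measure_isSigmaFinite.Build _ _ _
  (@lebesgue_rV n) (@lebesgue_rV_sigma_finiteT n).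

Lemma lebesgue_rV_box n (A : 'I_n -> set (measurableTypeR R)) :
  (forall i, measurable (A i)) ->
  lebesgue_rV [set x : 'rV[R]_n | forall i, A i (rV_coord i x)] =
  (\prod_(i < n) lebesgue_measure (A i))%E.
Proof.
elim: n A => [|n IH] A mA.
  by rewrite big_ord0 /= diracE mem_set//= => -[].
have mB : measurable
    [set v : 'rV[R]_n | forall i, A (lift ord0 i) (rV_coord i v)].
  rewrite (_ : mkset _ = \bigcap_(i in [set: 'I_n])
      (@rV_coord n i @^-1` A (lift ord0 i))).
    apply: fin_bigcap_measurable => // i _; rewrite -[X in measurable X]setTI.
    exact: measurable_rV_coord.
  by apply/seteqP; split => v/= H i; [move=> _|]; exact: H.
rewrite big_ord_recl -IH// -product_measure1E//.
congr ((lebesgue_measure \x @lebesgue_rV n)%E _).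
apply/seteqP; split => -[a v] /= H.
- split=> [|i]; first by have := H ord0; rewrite /rV_coord mxE unlift_none.
  by have := H (lift ord0 i); rewrite /rV_coord mxE liftK.
- move=> i; rewrite /rV_coord mxE.
  by case: (unliftP ord0 i) => [j ->|->]/=; [exact: H.2|exact: H.1].
Qed.

End euclidean_measure.

Section fractional_control.
Context {R : realType} {n : nat}.
Local Notation rV := 'rV[R]_n.
Local Notation mu := (@lebesgue_rV R n).
Implicit Types (Omega : set rV) (s : R) (u v w z : rV -> R).

(* `|x| is the sup norm on 'rV[R]_n, so the Euclidean norm is needed apart. *)
Definition enorm (x : rV) : R := Num.sqrt (\sum_i x ord0 i ^+ 2).

Definition bounded_domain Omega : Prop :=
  [/\ open Omega, connected Omega, Omega !=set0 & bounded_set Omega].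

Definition boundary Omega : set rV := closure Omega `\` Omega°.

(* Near each boundary point, in coordinates y = x *m Q rotated by some
   orthogonal Q, the set is the strict epigraph y_i > g(y') of a Lipschitz
   function g of the remaining coordinates y'. *)
Definition lipschitz_boundary Omega : Prop :=
  forall x0, boundary Omega x0 ->
  exists (r : R) (Q : 'M[R]_n) (i : 'I_n) (g : 'rV[R]_n.-1 -> R),
    [/\ 0 < r, Q *m Q^T = 1%:M, lipschitz (g : 'rV[R]_n.-1 -> R^o) &
      forall x, enorm (x - x0) < r ->
        (Omega x <-> g (col' i (x *m Q)) < (x *m Q) ord0 i)].

Definition exterior_ball_condition Omega : Prop :=
  exists2 rho : R, 0 < rho & forall x, boundary Omega x ->
    exists2 y, enorm (x - y) = rho &
      [set y' | enorm (y' - y) < rho] `&` Omega = set0.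

Definition partial (i : 'I_n) (phi : rV -> R) : rV -> R :=
  fun x => 'D_(delta_mx ord0 i) (phi : rV -> R^o) x.

(* All iterated partial derivatives exist and are continuous. *)
Definition smooth (phi : rV -> R) : Prop :=
  forall ds : seq 'I_n, let psi := foldr partial phi ds in
    continuous psi /\
    forall i x, derivable (psi : rV -> R^o) x (delta_mx ord0 i).

(* C_0^oo(Omega), extended by zero to R^n. *)
Definition test_function Omega (phi : rV -> R) : Prop :=
  let supp := closure [set x | phi x != 0] in
  [/\ smooth phi, compact supp & supp `<=` Omega].

(* D is meant to be measurable; values outside D are irrelevant. *)
Definition L2 (D : set rV) : set (rV -> R) :=
  [set u : rV -> R | measurable_fun D u /\
           (\int[mu]_(x in D) (u x ^+ 2)%:E < +oo)%E].

Definition L2_inner (D : set rV) u v : R := \int[mu]_(x in D) (u x * v x).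

Definition L2_norm (D : set rV) u : R := Num.sqrt (L2_inner D u u).

(* On the diagonal x = y the integrand is 0 / 0 = 0. *)
Definition gagliardo_sq s u : \bar R :=
  (\int[mu \x mu]_xy
     ((u xy.1 - u xy.2) ^+ 2 / enorm (xy.1 - xy.2) `^ (n%:R + 2 * s))%:E)%E.

Definition Hs_norm s u : \bar R :=
  ((\int[mu]_x (u x ^+ 2)%:E + gagliardo_sq s u) `^ 2^-1)%E.

Definition Hs s : set (rV -> R) :=
  [set u : rV -> R | L2 setT u /\ (gagliardo_sq s u < +oo)%E].

(* Closure of C_0^oo(Omega) in H^s(R^n).  Here and in the L2 spaces, elements
   are functions rather than a.e. classes. *)
Definition tHs s Omega : set (rV -> R) :=
  [set u : rV -> R | Hs s u /\ forall e : R, 0 < e ->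
     exists2 phi, test_function Omega phi & (Hs_norm s (u \- phi)%R < e%:E)%E].

(* H^{-s}(Omega): only the values of f on tHs s Omega matter, and the bound
   makes f respect a.e. equality there. *)
Definition dual_tHs s Omega (f : (rV -> R) -> R) : Prop :=
  (forall (k : R) v w, tHs s Omega v -> tHs s Omega w ->
     f (fun x => k * v x + w x) = k * f v + f w) /\
  (exists C : R, forall v, tHs s Omega v ->
     (`|f v|%:E <= C%:E * Hs_norm s v)%E).

Definition Gamma (x : R) : R :=
  \int[lebesgue_measure]_(t in `]0, +oo[) (t `^ (x - 1) * expR (- t)).

Definition frac_const s : R :=
  2 `^ (2 * s) * s * Gamma (s + n%:R / 2) /
  (pi `^ (n%:R / 2) * Gamma (1 - s)).

Definition frac_form s v w : R :=
  frac_const s / 2 *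
  \int[(mu \x mu)%E]_xy
     ((v xy.1 - v xy.2) * (w xy.1 - w xy.2) /
      enorm (xy.1 - xy.2) `^ (n%:R + 2 * s)).

Definition is_state s Omega (f : (rV -> R) -> R) z u : Prop :=
  tHs s Omega u /\
  forall v, tHs s Omega v -> frac_form s u v = f v + L2_inner Omega z v.

(* The state is only unique up to a.e. equality; a representative is chosen. *)
Definition control_to_state s Omega f z : rV -> R :=
  get [set u : rV -> R | is_state s Omega f z u].

Definition is_adjoint_state s Omega ud u p : Prop :=
  tHs s Omega p /\
  forall v, tHs s Omega v -> frac_form s v p = L2_inner Omega (u \- ud) v.

Definition adjoint_state s Omega ud u : rV -> R :=
  get [set p : rV -> R | is_adjoint_state s Omega ud u p].

Definition cost Omega ud alpha u z : R :=
  2^-1 * L2_norm Omega (u \- ud) ^+ 2 + alpha / 2 * L2_norm Omega z ^+ 2.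

Definition admissible Omega (a b : R) : set (rV -> R) :=
  [set w : rV -> R | L2 Omega w /\ {ae mu, forall x, Omega x -> a <= w x <= b}].

Definition optimal_control s Omega f ud (alpha a b : R) zbar : Prop :=
  admissible Omega a b zbar /\
  forall z, admissible Omega a b z ->
    cost Omega ud alpha (control_to_state s Omega f zbar) zbar <=
    cost Omega ud alpha (control_to_state s Omega f z) z.

End fractional_control.

(* Main.v *)
(** The difference quotient (u(x) - u(y)) |x - y|^(-(n+2s)/2) embeds H^s
    isometrically into L^2(R^n) x L^2(R^n x R^n), so completeness of H^s follows
    from a Riesz-Fischer argument, and a Poincare inequality makes the energy form
    coercive on the closed subspace of functions vanishing outside Omega.  The
    Riesz representation theorem then provides states and adjoint states.  With
    h = z - zbar and w = S z - S zbar, the adjoint equation gives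
      J(S z, z) = J(S zbar, zbar) + (pbar + alpha zbar, h)
                  + |w|^2 / 2 + alpha |h|^2 / 2,
    whose last two terms are nonnegative and, by stability, O(t^2) along
    zbar + t h. *)

Require Import Defs.
From mathcomp Require Import all_boot all_order all_algebra.
From mathcomp Require Import all_classical all_reals all_analysis.
From mathcomp Require Import measurable_realfun.
From mathcomp Require Import ring lra.
Import Order.TTheory GRing.Theory Num.Theory.
Import numFieldNormedType.Exports.
Local Open Scope classical_set_scope.
Local Open Scope ring_scope.

(** * Positive semidefinite forms on spaces of functions *)

(** Elements of [L2], [Hs] and [tHs] are functions, so their forms are only semidefinite and no
    normed quotient is formed: spaces are sets of functions, squared distances are values of a form,
    and limits are representatives up to null sets. Sequences are controlled at the rate [4 ^- k]
    throughout: squared increments of that size can be summed with weights [2 ^ k], which gives a.e.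
    convergence of the whole sequence even when the measure is infinite, without subsequences.
    Integrals in [R] are [fine] of extended ones, so +oo would become 0; this is why finiteness of
    the Gamma integral has to precede positivity of the constant in front of the energy form. *)

Section hilbert.
Context {R : realType} {T : Type}.
Implicit Types (V : set (T -> R)) (B : (T -> R) -> (T -> R) -> R).
Implicit Types (u v w : T -> R) (F : (T -> R) -> R).

Definition lin_closed V : Prop :=
  V (fun=> 0) /\
  forall (k : R) v w, V v -> V w -> V (fun x => k * v x + w x).

(** Linearity is asked on [V] only: real-valued integrals are additive on integrable functions, not
    on all functions. *)
Definition linear_on V F : Prop :=
  forall (k : R) v w, V v -> V w ->
    F (fun x => k * v x + w x) = k * F v + F w.

Definition psd_form V B : Prop :=
  [/\ forall u v, V u -> V v -> B u v = B v u,
      forall u, V u -> linear_on V (B^~ u) &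
      forall u, V u -> 0 <= B u u].

Context {V : set (T -> R)} {B : (T -> R) -> (T -> R) -> R}.
Hypotheses (Vlin : lin_closed V) (Bpsd : psd_form V B).

Lemma lin_closedB u v : V u -> V v -> V (fun x => u x - v x).
Proof.
move=> Vu Vv; rewrite (_ : (fun _ => _) = fun x => -1 * v x + u x).
  exact: Vlin.2.
by apply/funext => x; ring.
Qed.

Lemma lin_closedZ k u : V u -> V (fun x => k * u x).
Proof.
move=> Vu; rewrite (_ : (fun _ => _) = fun x => k * u x + 0).
  by apply: Vlin.2 => //; exact: Vlin.1.
by apply/funext => x; rewrite addr0.
Qed.

Lemma linear_onB F u v : linear_on V F -> V u -> V v ->
  F (fun x => u x - v x) = F u - F v.
Proof.
move=> lF Vu Vv; rewrite (_ : (fun _ => _) = fun x => -1 * v x + u x).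
  by rewrite lF//; ring.
by apply/funext => x; ring.
Qed.

Lemma linear_on0 F : linear_on V F -> F (fun=> 0) = 0.
Proof.
move=> lF; have := lF 1 _ _ Vlin.1 Vlin.1.
rewrite (_ : (fun _ => _) = fun=> 0); last by apply/funext => x; rewrite mul1r addr0.
by lra.
Qed.

Lemma linear_onZ F k u : linear_on V F -> V u -> F (fun x => k * u x) = k * F u.
Proof.
move=> lF Vu; have := lF k _ _ Vu Vlin.1; rewrite linear_on0// addr0 => <-.
by congr F; apply/funext => x; rewrite addr0.
Qed.

Lemma psd_form0 : B (fun=> 0) (fun=> 0) = 0.
Proof. have [_ linB _] := Bpsd; exact: (linear_on0 _ (linB _ Vlin.1)). Qed.

Lemma psd_formZ k u : V u -> B (fun x => k * u x) (fun x => k * u x) = k ^+ 2 * B u u.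
Proof.
have [symB linB _] := Bpsd => Vu; have Vk := lin_closedZ k u Vu.
have /= -> := linear_onZ _ k _ (linB _ Vk) Vu; rewrite symB//.
by have /= -> := linear_onZ _ k _ (linB _ Vu) Vu; rewrite mulrA.
Qed.

Lemma form_expand k u v : V u -> V v ->
  B (fun x => k * u x + v x) (fun x => k * u x + v x) =
  k ^+ 2 * B u u + 2 * k * B u v + B v v.
Proof.
move=> Vu Vv; have [symB linB _] := Bpsd.
have Vw := Vlin.2 k u v Vu Vv.
rewrite linB// (symB u)// (symB v)// !linB// (symB v u)//; ring.
Qed.

Lemma form_expandB u v : V u -> V v ->
  B (fun x => u x - v x) (fun x => u x - v x) = B u u - 2 * B u v + B v v.
Proof.
move=> Vu Vv; have [symB _ _] := Bpsd.
rewrite (_ : (fun _ => _) = fun x => -1 * v x + u x).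
  by rewrite form_expand// (symB v u)//; ring.
by apply/funext => x; ring.
Qed.

(** The case [x = 0] has to be covered, since the form is only semidefinite. *)
Lemma discriminant_le (x y e : R) : 0 <= x -> 0 <= e ->
  (forall t, 0 <= t ^+ 2 * x + 2 * t * y + e) -> y ^+ 2 <= x * e.
Proof.
move=> x0 e0 H; have [x00|xn0] := eqVneq x 0.
  rewrite x00 in H *; rewrite mul0r; have [->|yn0] := eqVneq y 0; first by rewrite expr0n.
  (* This [t] brings the affine function [2 * t * y + e] down to -1. *)
  have := H (- (e + 1) / (2 * y)).
  rewrite (_ : _ + _ = -1); last by field.
  by rewrite ler0N1.
have xp : 0 < x by rewrite lt_def xn0.
have := H (- y / x).
rewrite (_ : _ + _ = (x * e - y ^+ 2) / x); last by field.
by rewrite pmulr_lge0 ?invr_gt0// subr_ge0.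
Qed.

Lemma form_CauchySchwarz u v : V u -> V v -> B u v ^+ 2 <= B u u * B v v.
Proof.
move=> Vu Vv; have [_ _ B0] := Bpsd.
apply: discriminant_le; rewrite ?B0// => t.
by rewrite -form_expand//; apply: B0; exact: Vlin.2.
Qed.

(** Parallelogram law, with the nonnegative value of the form at [u + v] dropped. *)
Lemma form_triangle u v : V u -> V v ->
  B (fun x => u x - v x) (fun x => u x - v x) <= 2 * B u u + 2 * B v v.
Proof.
move=> Vu Vv; have [_ _ B0] := Bpsd.
have := B0 _ (Vlin.2 1 u v Vu Vv).
by rewrite form_expand// form_expandB//; lra.
Qed.

(** Archimedean substitute for letting [k] tend to infinity: a positive [x] would violate the bound
    once [4 ^ k] exceeds [K / x]. *)
Lemma geometric_le0 (K x : R) : (forall k, x <= K * 4 ^- k) -> x <= 0.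
Proof.
move=> H; rewrite leNgt; apply/negP => x0.
have K0 : 0 < K by have := H 0%N; rewrite expr0 invr1 mulr1; exact: lt_le_trans.
have := H (Num.bound (K / x)); rewrite leNgt => /negP; apply.
rewrite ltr_pdivrMr ?exprn_gt0// mulrC -ltr_pdivrMr//.
have := archi_boundP (divr_ge0 (ltW K0) (ltW x0)).
move: (Num.bound _) => k /lt_le_trans; apply.
by rewrite -natrX ler_nat ltnW// ltn_expl.
Qed.

(* Minimising [B v v / 2 - F v]: by the parallelogram law a minimising sequence
   is Cauchy; near-minimality of its terms passes to the limit as the
   Euler-Lagrange equation [B u v = F v]. *)
Lemma riesz_representation F (C : R) :
  0 <= C -> linear_on V F -> (forall v, V v -> F v ^+ 2 <= C * B v v) ->
  (forall us : nat -> T -> R, (forall k, V (us k)) ->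
    (forall k j, (k <= j)%N ->
      B (fun x => us j x - us k x) (fun x => us j x - us k x) <= 4 ^- k) ->
    exists2 u, V u & exists C' : R, forall k,
      B (fun x => u x - us k x) (fun x => u x - us k x) <= C' * 4 ^- k) ->
  exists2 u, V u & forall v, V v -> B u v = F v.
Proof.
move=> C0 linF bF complete; have [symB linB B0] := Bpsd.
pose Phi v := B v v / 2 - F v.
have PhiE v w t : V v -> V w -> Phi (fun x => t * v x + w x) =
    t ^+ 2 * (B v v / 2) + t * (B v w - F v) + Phi w.
  by move=> Vv Vw; rewrite /Phi form_expand// linF//; field.
have lbPhi v : V v -> - (C / 2) <= Phi v.
  (* If not, [x + C < 2 * y]; squaring and [y ^+ 2 <= C * x] give [(x - C) ^+ 2 < 0]. *)
  move=> Vv; have := bF v Vv; have := B0 v Vv; rewrite /Phi.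
  move: (F v) (B v v) => y x x0 yC; rewrite leNgt; apply/negP => lt.
  have : (x + C) ^+ 2 < (2 * y) ^+ 2 by rewrite ltrXn2r//; lra.
  by have := sqr_ge0 (x - C); lra.
pose m := inf (Phi @` V).
have hinf : has_inf (Phi @` V).
  split; first by exists (Phi (fun=> 0)), (fun=> 0) => //; exact: Vlin.1.
  by exists (- (C / 2)) => _ [v Vv <-]; exact: lbPhi.
have m_le v : V v -> m <= Phi v.
  by move=> Vv; apply: ge_inf; [exact: hinf.2|exists v].
(* Convexity at the midpoint bounds [B d d / 8] by the mean of the two gaps to [m], so the factor
   1/8 makes the increments at most [4 ^- k]. *)
pose e k : R := 8^-1 * 4 ^- k.
have e0 k : 0 < e k by rewrite /e mulr_gt0// invr_gt0// exprn_gt0.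
have /choice[us usP] : forall k, exists u, V u /\ Phi u < m + e k.
  move=> k; have [_ [v Vv <-] vk] := inf_adherent (e0 k) hinf.
  by exists v.
have eS k j : (k <= j)%N -> e j <= e k.
  move=> kj; rewrite /e ler_pM2l// lef_pV2 ?posrE ?exprn_gt0//.
  by rewrite ler_weXn2l// ler1n.
have [|k j kj|u Vu [C' uC']] := complete us.
- by move=> k; exact: (usP k).1.
- have [Vj Pj] := usP j; have [Vk Pk] := usP k.
  set d := fun x => us j x - us k x.
  have Vd : V d by exact: lin_closedB.
  have := m_le _ (Vlin.2 2^-1 d (us k) Vd Vk); rewrite PhiE//.
  have : Phi (us j) = Phi (fun x => 1 * d x + us k x).
    by congr Phi; apply/funext => x; rewrite /d; ring.
  rewrite PhiE//; have := eS k j kj; have : e k = 8^-1 * 4 ^- k by [].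
  move: (4 ^- k) Pj Pk => q; rewrite -/d; lra.
exists u => // v Vv; apply/eqP; rewrite -subr_eq0 -sqrf_eq0.
rewrite eq_le sqr_ge0 andbT.
(* Split [B u v - F v] at [B (us k) v]: twice the squares of the two parts are at most
   [2 * C' * B v v * 4 ^- k] and [B v v / 2 * 4 ^- k]. *)
apply: (@geometric_le0 (B v v * (2^-1 + 2 * C'))) => k.
have [Vk Pk] := usP k.
have Vd : V (fun x => u x - us k x) by exact: lin_closedB.
have Bvv := B0 v Vv.
(* Moving from [us k] along [v] cannot lower [Phi] by more than [e k], so a quadratic in [t] is
   nonnegative and its discriminant bounds the residual. *)
have : ((B v (us k) - F v) / 2) ^+ 2 <= B v v / 2 * e k.
  apply: discriminant_le; [lra|exact: ltW|move=> t].
  have := m_le _ (Vlin.2 t v (us k) Vv Vk); rewrite PhiE//; lra.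
have : B (fun x => u x - us k x) v ^+ 2 <= C' * 4 ^- k * B v v.
  apply: le_trans (form_CauchySchwarz _ _ Vd Vv) _.
  by apply: ler_wpM2r.
have /= -> := linear_onB _ _ _ (linB v Vv) Vu Vk.
rewrite (symB v (us k))// /e.
have := sqr_ge0 ((B u v - B (us k) v) - (B (us k) v - F v)).
move: (4 ^- k) => q; lra.
Qed.
End hilbert.

Section form_closure.
Context {R : realType} {T : Type}.
Context {V W : set (T -> R)} {B : (T -> R) -> (T -> R) -> R}.
Hypotheses (Vlin : lin_closed V) (Wlin : lin_closed W) (Bpsd : psd_form V B).

(** [B] measures squared distance, so [e] plays the part of a squared radius. The approximants must
    lie in [V], where [B] is known to be a form. *)
Definition form_closure : set (T -> R) :=
  [set u | V u /\ forall e : R, 0 < e ->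
    exists2 w, V w /\ W w & B (fun x => u x - w x) (fun x => u x - w x) < e].

Lemma form_closure_lin_closed : lin_closed form_closure.
Proof.
have [V0 VZ] := Vlin; have [W0 WZ] := Wlin; have [_ linB B0] := Bpsd.
split.
  split=> // e e0; exists (fun=> 0) => //.
  rewrite (_ : (fun _ => _) = fun=> 0); last by apply/funext => x; rewrite subr0.
  by rewrite (psd_form0 Vlin Bpsd).
move=> k u v [Vu cu] [Vv cv]; split=> [|e e0]; first exact: VZ.
(* The triangle bound yields [2 * (e / 4) + 2 * k ^+ 2 * e / (4 * (k ^+ 2 + 1))], less than [e]; the
   added 1 keeps the divisor positive when [k = 0]. *)
have K0 : 0 < 4 * (k ^+ 2 + 1) by have := sqr_ge0 k; lra.
have [u' [Vu' Wu'] uu'] := cu _ (divr_gt0 e0 K0).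
have [v' [Vv' Wv'] vv'] := cv _ (divr_gt0 e0 (ltr0Sn R 3)).
exists (fun x => k * u' x + v' x); first by split; [exact: VZ|exact: WZ].
pose du := fun x => u x - u' x; pose dv := fun x => v x - v' x.
have Vdu : V du by exact: lin_closedB.
have Vdv : V dv by exact: lin_closedB.
have Vk : V (fun x => - k * du x) by exact: lin_closedZ.
rewrite (_ : (fun _ => _) = fun x => dv x - (- k * du x)); last first.
  by apply/funext => x; rewrite /du /dv; ring.
apply: le_lt_trans (form_triangle Vlin Bpsd _ _ Vdv Vk) _.
rewrite (psd_formZ Vlin Bpsd)// sqrrN.
have := B0 _ Vdu; rewrite -/du -/dv in uu' vv' *.
move: uu'; rewrite ltr_pdivlMr//; nra.
Qed.

Lemma form_closure_closed u : V u ->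
  (forall e : R, 0 < e -> exists2 v, form_closure v &
    B (fun x => u x - v x) (fun x => u x - v x) < e) ->
  form_closure u.
Proof.
move=> Vu H; split=> // e e0.
have e4 : 0 < e / 4 by lra.
have [v [Vv cv] uv] := H _ e4.
have [w [Vw Ww] vw] := cv _ e4.
exists w => //.
rewrite (_ : (fun _ => _) = fun x => (u x - v x) - (w x - v x)); last first.
  by apply/funext => x; ring.
have Vuv : V (fun x => u x - v x) by exact: lin_closedB.
have Vwv : V (fun x => w x - v x) by exact: lin_closedB.
have := form_triangle Vlin Bpsd _ _ Vuv Vwv.
rewrite [in X in _ <= X](form_expandB Vlin Bpsd w)//.
rewrite (form_expandB Vlin Bpsd v w)// in vw.
have [symB _ _] := Bpsd; rewrite (symB w v)//; lra.
Qed.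
End form_closure.
Arguments form_closure {R T} V W B.

(** * Square-integrable functions *)

Section square_integrable.
Context {d : measure_display} {T : measurableType d} {R : realType}.
Context (m : {measure set T -> \bar R}) (D : set T).
Implicit Types u v : T -> R.

(* [L2 D] is [sqint lebesgue_rV D], up to conversion. *)
Definition sqint : set (T -> R) :=
  [set u : T -> R | measurable_fun D u /\ (\int[m]_(x in D) (u x ^+ 2)%:E < +oo)%E].

(** Generic in the measure: it serves on [Omega], on R^n, and on R^n x R^n for the difference
    quotients. It agrees with [L2_inner] by conversion. *)
Definition inner u v : R := \int[m]_(x in D) (u x * v x).

Hypothesis mD : measurable D.

Lemma measurable_sq u : measurable_fun D u ->
  measurable_fun D (fun x => (u x ^+ 2)%:E).
Proof. by move=> mu; apply/measurable_EFinP; exact: measurable_funX. Qed.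

(** Domination of [u * v] by [u ^+ 2 + v ^+ 2]. *)
Lemma sqint_integrable u v : sqint u -> sqint v ->
  m.-integrable D (EFin \o (fun x => u x * v x)).
Proof.
move=> [mu Iu] [mv Iv].
have Iuv : m.-integrable D (fun x => (u x ^+ 2)%:E + (v x ^+ 2)%:E)%E.
  apply/integrableP; split.
    by apply: emeasurable_funD; exact: measurable_sq.
  under eq_integral do rewrite gee0_abs ?adde_ge0 ?lee_fin ?sqr_ge0//.
  rewrite ge0_integralD//; first exact: lte_add_pinfty.
  - by move=> x _; rewrite lee_fin sqr_ge0.
  - exact: measurable_sq.
  - by move=> x _; rewrite lee_fin sqr_ge0.
  - exact: measurable_sq.
apply: le_integrable Iuv => //.
  by apply/measurable_EFinP; exact: measurable_funM.
move=> x _ /=; rewrite lee_fin [leRHS]ger0_norm ?addr_ge0 ?sqr_ge0// ler_norml.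
have := sqr_ge0 (u x - v x); have := sqr_ge0 (u x + v x).
have := sqr_ge0 (u x); have := sqr_ge0 (v x).
by move=> ? ? ? ?; apply/andP; split; lra.
Qed.

(** Bridge between real inner products and extended integrals; membership in [sqint] excludes the
    value +oo, which [fine] would send to 0. *)
Lemma inner_sqE u : sqint u ->
  (inner u u)%:E = (\int[m]_(x in D) (u x ^+ 2)%:E)%E.
Proof.
move=> [mu Iu]; rewrite /inner /Rintegral fineK//.
rewrite ge0_fin_numE//; apply: integral_ge0 => x _.
by rewrite lee_fin -expr2 sqr_ge0.
Qed.

Lemma sqint_lin_closed : lin_closed sqint.
Proof.
split.
  split; first exact: measurable_cst.
  by under eq_integral do rewrite expr0n/=; rewrite integral0.
move=> k u v su sv; have [mu _] := su; have [mv _] := sv.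
split.
  by apply: measurable_funD => //; apply: measurable_funM => //; exact: measurable_cst.
have Iuu := sqint_integrable u u su su; have Ivv := sqint_integrable v v sv sv.
have Iuv := sqint_integrable u v su sv.
apply: integrable_lty => //.
rewrite (_ : (fun _ => _) = fun x =>
   ((k ^+ 2)%:E * (u x * u x)%:E + (2 * k)%:E * (u x * v x)%:E + (v x * v x)%:E)%E).
  apply: integrableD => //; apply: integrableD => //; exact: integrableZl.
by apply/funext => x; rewrite -!EFinM -!EFinD; congr EFin; ring.
Qed.

Lemma inner_sym u v : inner u v = inner v u.
Proof. by apply: eq_Rintegral => x _; rewrite mulrC. Qed.

Lemma inner_linear u : sqint u -> linear_on sqint (inner^~ u).
Proof.
move=> su k v w sv sw /=.
have Ivu := sqint_integrable v u sv su; have Iwu := sqint_integrable w u sw su.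
rewrite /inner -RintegralZl// -RintegralD//.
  by apply: eq_Rintegral => x _; ring.
by have := integrableZl mD k Ivu; apply: eq_integrable => // x _ /=; rewrite EFinM.
Qed.

Lemma inner_psd : psd_form sqint inner.
Proof.
split=> [u v _ _|u|u _]; [exact: inner_sym|exact: inner_linear|].
by apply: Rintegral_ge0 => x _; rewrite -expr2 sqr_ge0.
Qed.

End square_integrable.

(** * Riesz-Fischer: Fatou bounds and almost everywhere convergence *)

Section riesz_fischer.
Context {d : measure_display} {T : measurableType d} {R : realType}.
Context (m : {measure set T -> \bar R}).

(** Fatou's lemma, since [g ^+ 2] is almost everywhere the lower limit of the [f j ^+ 2]. *)
Lemma sq_fatou (f : nat -> T -> R) (g : T -> R) (C : \bar R) :
  (forall j, measurable_fun setT (f j)) -> measurable_fun setT g ->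
  {ae m, forall x, f^~ x @ \oo --> g x} ->
  (forall j, \int[m]_x (f j x ^+ 2)%:E <= C)%E ->
  (\int[m]_x (g x ^+ 2)%:E <= C)%E.
Proof.
move=> mf mg fg fC.
have m2 j : measurable_fun setT (fun x => (f j x ^+ 2)%:E) by exact: measurable_sq.
have einfE x : limn_einf (fun j => (f j x ^+ 2)%:E) =
    (- limn_esup (fun j => - (f j x ^+ 2)%:E))%E.
  by have := limn_esupN (fun j => (f j x ^+ 2)%:E); rewrite /comp => ->; rewrite oppeK.
rewrite (@ge0_ae_eq_integral _ _ _ m setT _
  (fun x => limn_einf (fun j => (f j x ^+ 2)%:E)))//.
- apply: le_trans (fatou _ _ _ _) _ => //.
    by move=> j x _; rewrite lee_fin sqr_ge0.
  rewrite limn_einf_lim; apply: lime_le; first exact: is_cvg_einfs.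
  apply: nearW => j; apply: le_trans (fC j).
  by apply: ereal_inf_lbound; exists j => /=.
- exact: measurable_sq.
- rewrite (_ : (fun _ => _) = (fun x => - limn_esup (fun j => - (f j x ^+ 2)%:E))%E);
    last by apply/funext => x; rewrite einfE.
  apply: measurableT_comp => //; apply: measurable_fun_limn_esup => j.
  exact: measurableT_comp.
- by move=> x _; rewrite lee_fin sqr_ge0.
- move=> x _; rewrite limn_einf_lim; apply: lime_ge; first exact: is_cvg_einfs.
  by apply: nearW => j; apply: le_ereal_inf_tmp => _ [k _ <-]; rewrite lee_fin sqr_ge0.
- apply: filterS fg => x fx _ /=.
  suff : (fun j => (f j x ^+ 2)%:E) @ \oo --> (g x ^+ 2)%:E.
    by move=> /cvg_limn_einf_sup[->].
  apply: cvg_EFin; first exact: nearW.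
  have : (fun j => f j x * f j x) @ \oo --> g x * g x by exact: cvgM.
  by apply: cvg_trans; apply: near_eq_cvg; apply: nearW.
Qed.

Let half_series_le k : \sum_(0 <= i < k) 2^-1 ^+ i <= 2 :> R.
Proof.
have -> : \sum_(0 <= i < k) 2^-1 ^+ i = series (geometric 1 2^-1) k :> R.
  by rewrite seriesEnat /=; apply: eq_bigr => i _; rewrite mul1r.
apply: le_trans (@geometric_le_lim R k 1 2^-1 _ _ _) _ => //.
  by rewrite ger0_norm// invf_lt1// ltr1n.
by rewrite mul1r (_ : 1 - 2^-1 = 2^-1) ?invrK//; lra.
Qed.

(** Weighted by [2 ^ k], the integrals of the squared increments still sum to at most [C * 2], so
    the weighted series of squares is finite a.e.; by Young's inequality it controls the series of
    increments. The L^1 norms of the increments are avoided, as the measure may be infinite. *)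
Lemma ae_cvg_of_fast_cauchy (C : R) (f : nat -> T -> R) :
  (forall j, measurable_fun setT (f j)) ->
  (forall j, \int[m]_x ((f j.+1 x - f j x) ^+ 2)%:E <= (C * 4 ^- j)%:E)%E ->
  {ae m, forall x, cvgn (f^~ x)}.
Proof.
move=> mf fC.
have C0 : 0 <= C.
  rewrite -lee_fin; have := fC 0; rewrite expr0 invr1 mulr1; apply: le_trans.
  by apply: integral_ge0 => x _; rewrite lee_fin sqr_ge0.
pose a k x : R := 2 ^+ k * (f k.+1 x - f k x) ^+ 2.
have a0 k x : (0 <= (a k x)%:E)%E by rewrite lee_fin mulr_ge0 ?sqr_ge0// exprn_ge0.
have ma k : measurable_fun setT (fun x => (a k x)%:E).
  apply/measurable_EFinP; apply: measurable_funM => //.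
  by apply: measurable_funX; exact: measurable_funB.
have mg : measurable_fun setT (fun x => \sum_(k <oo) (a k x)%:E)%E.
  exact: ge0_emeasurable_sum.
have ig : m.-integrable setT (fun x => \sum_(k <oo) (a k x)%:E)%E.
  apply/integrableP; split => //.
  under eq_integral do rewrite gee0_abs ?nneseries_ge0//.
  rewrite integral_nneseries//.
  apply: (@le_lt_trans _ _ (\sum_(k <oo) (C * 2^-1 ^+ k)%:E)%E).
    apply: lee_nneseries => [k _ _|k _]; first exact: integral_ge0.
    under eq_integral do rewrite EFinM.
    rewrite ge0_integralZl_EFin//; last 2 first.
    - by move=> x _; rewrite lee_fin sqr_ge0.
    - by apply: measurable_sq => //; exact: measurable_funB.
    apply: le_trans (lee_wpmul2l _ (fC k)) _; first by rewrite lee_fin exprn_ge0.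
    rewrite -EFinM lee_fin exprVn (_ : 4 = 2 * 2); last by ring.
    by rewrite mulrCA exprMn invfM [_ ^+ k * _]mulrA mulfV ?mul1r// expf_neq0.
  apply: (@le_lt_trans _ _ (C * 2)%:E); last exact: ltry.
  apply: lime_le; first by apply: is_cvg_nneseries => k _ _; rewrite lee_fin mulr_ge0// exprn_ge0.
  by apply: nearW => k; rewrite sumEFin lee_fin -mulr_sumr ler_wpM2l// half_series_le.
have := integrable_ae measurableT ig; apply: filterS => x /= /(_ I) gx.
set M := fine (\sum_(k <oo) (a k x)%:E)%E.
have aM k : \sum_(0 <= i < k) a i x <= M.
  rewrite -lee_fin fineK// -sumEFin; exact: nneseries_lim_ge.
pose dd k := f k.+1 x - f k x.
have cdd : cvgn [normed series dd].
  apply: nondecreasing_is_cvgn.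
    by apply: nondecreasing_series => k _ _; exact: normr_ge0.
  exists ((M + 2) / 2) => _ [k _ <-].
  have : \sum_(0 <= i < k) `|dd i| <= \sum_(0 <= i < k) (a i x / 2 + 2^-1 * 2^-1 ^+ i).
    apply: ler_sum => i _; rewrite /a -/(dd i) exprVn.
    have p0 : 0 < (2:R) ^+ i by exact: exprn_gt0.
    (* Completed square behind [2 * |dd i| <= 2 ^ i * dd i ^+ 2 + 2 ^- i]. *)
    have : 0 <= 2 ^- i * (2 ^+ i * `|dd i| - 1) ^+ 2.
      by rewrite mulr_ge0 ?sqr_ge0// invr_ge0 ltW.
    rewrite -(real_normK (num_real (dd i))).
    have -> : 2 ^- i * (2 ^+ i * `|dd i| - 1) ^+ 2 =
      2 ^+ i * `|dd i| ^+ 2 - 2 * `|dd i| + 2 ^- i by field; exact: lt0r_neq0.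
    by lra.
  rewrite big_split/= -mulr_suml => /le_trans; apply.
  by have := aM k; have := half_series_le k; rewrite -mulr_sumr; lra.
have /cvg_ex[l cl] := normed_cvg cdd.
apply/cvg_ex; exists (f 0%N x + l).
rewrite (_ : f^~ x = fun k => f 0%N x + series dd k).
  by apply: cvgD => //; exact: cvg_cst.
by apply/funext => k; rewrite /= (eq_sum_telescope (f^~ x)).
Qed.
End riesz_fischer.

(** * Positivity of the normalising constant *)

Section gamma.
Context {R : realType}.
Local Notation mu := (@lebesgue_measure R).
Implicit Types x t : R.

Let integrand x t := t `^ (x - 1) * expR (- t).

Let integrand_ge0 x t : 0 <= integrand x t.
Proof. by rewrite mulr_ge0// ?powR_ge0// expR_ge0. Qed.

Let measurable_integrand x D : measurable_fun D (integrand x).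
Proof.
apply: measurable_funTS; apply: measurable_funM => //.
by apply: measurableT_comp => //; exact: measurable_oppr.
Qed.

Let is_derive_powR_primitive x t : x != 0 -> 0 < t ->
  is_derive t 1 (fun u => x^-1 * u `^ x) (t `^ (x - 1)).
Proof.
move=> x0 t0; have dP := is_derive1_powR x t0.
have := is_deriveZ x^-1 dP.
by rewrite (_ : x^-1 *: _ = t `^ (x - 1)) // /GRing.scale /= mulKf.
Qed.

(** The singularity at 0 is approached by compact intervals, on which the primitive t^x / x bounds
    every integral by [x^-1]. *)
Lemma powR_integral_ltoo x : 0 < x ->
  (\int[mu]_(t in `]0%R, 1%R]) (t `^ (x - 1))%:E < +oo)%E.
Proof.
(* [k.+2] keeps the left endpoint strictly below 1, so no interval degenerates. *)
move=> x0; pose F k : set R := `[k.+2%:R^-1, 1]%classic.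
have -> : `]0%R, 1%R]%classic = \bigcup_k F k.
  apply/seteqP; split => [t|t [k _]]; rewrite /F /= !in_itv /=.
    move=> /andP[t0 t1]; exists (Num.bound t^-1) => //=.
    rewrite /= in_itv/= t1 andbT -[leRHS]invrK lef_pV2 ?posrE ?invr_gt0//.
    rewrite ltW//; apply: lt_le_trans (archi_boundP _) _.
      by rewrite invr_ge0 ltW.
    by rewrite ler_nat; apply: leq_trans (leqnSn _) _.
  by move=> /andP[kt ->]; rewrite andbT (lt_le_trans _ kt)// invr_gt0.
have mF k : measurable (F k) by exact: measurable_itv.
have F0 k t : F k t -> 0 < t.
  by rewrite /F /= in_itv /= => /andP[kt _]; rewrite (lt_le_trans _ kt)// invr_gt0.
have mf D : measurable_fun D (fun t => (t `^ (x - 1))%:E).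
  by apply/measurable_EFinP; apply: measurable_funTS.
have ndF : nondecreasing_seq F.
  move=> i j ij; apply/subsetPset => t; rewrite /F /= !in_itv /= => /andP[it ->].
  by rewrite andbT (le_trans _ it)// lef_pV2 ?posrE// ler_nat.
have f0 i t : F i t -> (0 <= (t `^ (x - 1))%:E)%E by rewrite lee_fin powR_ge0.
have cI := @ge0_nondecreasing_set_cvg_integral _ _ _ _ _ mu ndF mF (fun i => mf (F i)) f0.
rewrite -(cvg_lim _ cI)//.
apply: (@le_lt_trans _ _ (x^-1)%:E); last exact: ltry.
apply: lime_le; first exact: cvgP cI.
apply: nearW => k.
have k1 : k.+2%:R^-1 < 1 :> R by rewrite invf_lt1// ltr1n.
rewrite (@continuous_FTC2 _ _ (fun t => x^-1 * t `^ x))//.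
- by rewrite -EFinB lee_fin powR1 mulr1 gerBl mulr_ge0 ?powR_ge0// invr_ge0 ltW.
- apply: continuous_in_subspaceT => t; rewrite inE => /F0 t0.
  have [dv _] := is_derive1_powR (x - 1) t0.
  exact/differentiable_continuous/derivable1_diffP.
- have c t : 0 < t -> {for t, continuous (fun u => x^-1 * u `^ x)}.
    move=> t0; have [dv _] := is_derive_powR_primitive _ _ (lt0r_neq0 x0) t0.
    exact/differentiable_continuous/derivable1_diffP.
  split=> [t||].
  + rewrite in_itv/= => /andP[kt _].
    have t0 : 0 < t by rewrite (lt_trans _ kt)// invr_gt0.
    by have [] := is_derive_powR_primitive _ _ (lt0r_neq0 x0) t0.
  + by apply: cvg_at_right_filter; apply: c; rewrite invr_gt0.
  + by apply: cvg_at_left_filter; exact: c.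
- move=> t; rewrite in_itv/= => /andP[kt _].
  have t0 : 0 < t by rewrite (lt_trans _ kt)// invr_gt0.
  have := is_derive_powR_primitive _ _ (lt0r_neq0 x0) t0.
  by move=> dt; rewrite derive1E derive_val.
Qed.

Lemma Gamma_integral_ltoo x : 0 < x ->
  (\int[mu]_(t in `]0%R, +oo[) (integrand x t)%:E < +oo)%E.
Proof.
move=> x0.
have -> : `]0%R, +oo[%classic = `]0%R, 1%R]%classic `|` `]1%R, +oo[%classic :> set R.
  by rewrite -itv_bndbnd_setU// bnd_simp.
rewrite ge0_integral_setU//; last 3 first.
- by apply/measurable_EFinP; exact: measurable_integrand.
- by move=> t _; rewrite lee_fin; exact: integrand_ge0.
- apply/disj_setPS => t [] /=; rewrite !in_itv/= andbT => /andP[_ t1] /lt_le_trans-/(_ _ t1).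
  by rewrite ltxx.
apply: lte_add_pinfty.
  apply: le_lt_trans (powR_integral_ltoo x x0).
  apply: ge0_le_integral => //.
  - by move=> t _; rewrite lee_fin.
  - by apply/measurable_EFinP; exact: measurable_integrand.
  - by apply/measurable_EFinP; exact: measurable_funTS.
  move=> t; rewrite /= in_itv /= => /andP[t0 _]; rewrite lee_fin ler_piMr ?powR_ge0//.
  by rewrite -expR0 ler_expR oppr_le0 ltW.
(* [y] dominates [x - 1] and is positive; [ln r < r] at [r = t / (2 * y)] gives t^y <= K exp(t / 2),
   which leaves a multiple of the exponential density of rate 1/2. *)
pose y := `|x| + 1; pose K := expR (y * ln (2 * y)).
have pdf0 t : 0 <= exponential_pdf (2^-1 : R) t by apply: exponential_pdf_ge0.
have mpdf D : measurable_fun D (fun t => (exponential_pdf (2^-1 : R) t)%:E).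
  apply/measurable_EFinP; apply: measurable_funTS; exact: measurable_exponential_pdf.
apply: (@le_lt_trans _ _ (\int[mu]_t ((2 * K)%:E * (exponential_pdf 2^-1 t)%:E))%E).
  have K0 : 0 <= 2 * K by rewrite mulr_ge0// expR_ge0.
  have m2 D : measurable_fun D (fun t => (2 * K)%:E * (exponential_pdf 2^-1 t)%:E)%E.
    exact: measurable_funeM.
  apply: (@le_trans _ _ (\int[mu]_(t in `]1%R, +oo[) ((2 * K)%:E * (exponential_pdf 2^-1 t)%:E))%E).
    apply: ge0_le_integral => //.
    - by move=> t _; rewrite lee_fin; exact: integrand_ge0.
    - by apply/measurable_EFinP; exact: measurable_integrand.
    - exact: m2.
    move=> t; rewrite /= in_itv/= andbT => t1; rewrite -EFinM lee_fin.
    have t0 : 0 < t by exact: lt_trans t1.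
    rewrite (exponential_pdfE _ (ltW t0)).
    have y1 : 1 <= y by rewrite lerDr.
    have y0 : 0 < y by exact: lt_le_trans y1.
    have y2 : 0 < 2 * y by exact: mulr_gt0.
    have ty : x - 1 <= y by have := ler_norm x; rewrite /y; lra.
    apply: (@le_trans _ _ (t `^ y * expR (- t))).
      by rewrite ler_wpM2r ?expR_ge0// ler_powR// ltW.
    rewrite /powR (gt_eqF t0) -expRD.
    rewrite (_ : 2 * K * (2^-1 * _) = K * expR (- 2^-1 * t)); last by field.
    rewrite -expRD ler_expR.
    have := ln_sublinear (divr_gt0 t0 y2).
    rewrite ln_div ?posrE// ltrBlDr => /ltW lnt.
    have := ler_wpM2l (ltW y0) lnt.
    rewrite mulrDr (_ : y * (t / (2 * y)) = 2^-1 * t); last by field; exact: lt0r_neq0.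
    by lra.
  apply: ge0_subset_integral => //; first exact: m2.
  by move=> t _; rewrite -EFinM lee_fin mulr_ge0.
rewrite ge0_integralZl_EFin//.
- by rewrite integral_exponential_pdf// mule1 ltry.
- by move=> t _; rewrite lee_fin.
- exact: mpdf.
- by rewrite mulr_ge0// expR_ge0.
Qed.

(** [fine] of the integral is positive only when the integral is both positive and finite. The lower
    bound comes from [[1, 2]], where the integrand stays above a positive constant. *)
Lemma Gamma_gt0 x : 0 < x -> 0 < Gamma x.
Proof.
move=> x0; rewrite /Gamma /Rintegral fine_gt0// Gamma_integral_ltoo// andbT.
pose c : R := (2 `^ `|x - 1|)^-1 * expR (- 2).
have c0 : 0 < c by rewrite mulr_gt0 ?expR_gt0// invr_gt0 powR_gt0.
have mI D : measurable_fun D (fun t => (t `^ (x - 1) * expR (- t))%:E).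
  by apply/measurable_EFinP; exact: measurable_integrand.
apply: (@lt_le_trans _ _ (\int[mu]_(t in `[1%R, 2%R]) c%:E)%E).
  rewrite integral_cst//= lebesgue_measure_itv/= lte_fin ltr1n -EFinD mule_gt0//.
apply: (@le_trans _ _ (\int[mu]_(t in `[1%R, 2%R]) (t `^ (x - 1) * expR (- t))%:E)%E).
  apply: ge0_le_integral => //.
  - by move=> t _; rewrite lee_fin ltW.
  - exact: mI.
  move=> t; rewrite /= in_itv/= => /andP[t1 t2]; rewrite lee_fin.
  have t0 : 0 < t by exact: lt_le_trans t1.
  apply: ler_pM; rewrite ?expR_ge0 ?invr_ge0 ?powR_ge0//.
    apply: (@le_trans _ _ (t `^ (- `|x - 1|))).
      rewrite powRN lef_pV2 ?posrE ?powR_gt0//.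
      by apply: ge0_ler_powR => //; rewrite nnegrE ltW.
    by rewrite ler_powR// lerNl -normrN ler_norm.
  by rewrite ler_expR lerN2.
apply: ge0_subset_integral => //.
- exact: mI.
- by move=> t _; rewrite lee_fin; exact: integrand_ge0.
- by move=> t; rewrite /= !in_itv/= andbT => /andP[t1 _]; exact: lt_le_trans t1.
Qed.

Lemma frac_const_gt0 n s : 0 < s -> s < 1 -> 0 < @frac_const R n s.
Proof.
move=> s0 s1; rewrite /frac_const divr_gt0// !mulr_gt0// ?powR_gt0 ?pi_gt0//.
- by apply: Gamma_gt0; rewrite ltr_wpDr// divr_ge0.
- by apply: Gamma_gt0; rewrite subr_gt0.
Qed.
End gamma.

(** * Borel sets of R^n and test functions *)

Section rV_borel.
Context {R : realType} {n : nat}.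
Local Notation rV := 'rV[R]_n.

Lemma measurable_rV_box (A : 'I_n -> set (measurableTypeR R)) :
  (forall i, measurable (A i)) ->
  measurable [set x : rV | forall i, A i (rV_coord i x)].
Proof.
move=> mA; rewrite (_ : mkset _ = \bigcap_(i in [set: 'I_n])
    (@rV_coord R n i @^-1` A i)).
  apply: fin_bigcap_measurable => // i _; rewrite -[X in measurable X]setTI.
  exact: measurable_rV_coord.
by apply/seteqP; split => v/= H i; [move=> _|]; exact: H.
Qed.

(** The sigma-algebra is generated by the coordinates, so an open set is written as the union of the
    boxes with rational centre and radius [1 / (k + 1)] that it contains, a countable family. *)
Lemma open_measurable_rV (U : set rV) : open U -> measurable U.
Proof.
move=> oU.
pose box (qk : 'rV[rat]_n * nat) : set rV :=
  [set x | forall i, ball (ratr (qk.1 ord0 i) : R) qk.2.+1%:R^-1 (x ord0 i)].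
pose F qk := if pselect (box qk `<=` U) then box qk else set0.
have -> : U = \bigcup_qk F qk.
  apply/seteqP; split; last first.
    by move=> x [qk _]; rewrite /F; case: pselect => // bU; exact: bU.
  move=> x Ux; have /nbhs_ballP[e /= e0 eU] := open_nbhs_nbhs (conj oU Ux).
  (* With a radius below [e / 2], a box that contains [x] stays in the [e]-ball of [x]. *)
  pose k := Num.bound (2 / e).
  have ke : k.+1%:R^-1 < e / 2.
    rewrite -[ltRHS]invrK ltf_pV2 ?posrE ?invr_gt0 ?divr_gt0// invf_div.
    apply: lt_le_trans (archi_boundP _) _; first by rewrite divr_ge0// ltW.
    by rewrite ler_nat.
  have k0 : 0 < k.+1%:R^-1 :> R by rewrite invr_gt0.
  have /choice[q qP] : forall i, exists q : rat,
      ball (ratr q : R) k.+1%:R^-1 (x ord0 i).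
    move=> i; have [|q] := @rat_in_itvoo R (x ord0 i - k.+1%:R^-1) (x ord0 i).
      by rewrite ltrBlDr ltrDl.
    rewrite in_itv/= => /andP[q1 q2]; exists q.
    rewrite /ball/= ltr_norml; move: q1 q2 k0; move: (k.+1%:R^-1) (ratr q : R) => r q'.
    by move=> ? ? ?; apply/andP; split; lra.
  exists (\row_i q i, k) => //; rewrite /F; case: pselect => /= [_|].
    by move=> i /=; rewrite mxE; exact: qP.
  move=> nU; exfalso; apply: nU => y yb; apply: eU; split=> // i j; rewrite ord1.
  have := yb j; rewrite /= mxE => yq.
  apply: (@le_ball _ _ _ (k.+1%:R^-1 + k.+1%:R^-1)).
    by move: ke; move: (k.+1%:R^-1) => r; lra.
  by apply: ball_triangle yq; apply: ball_sym; exact: qP.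
apply: countable_bigcupT_measurable; first exact: countableP.
move=> qk; rewrite /F; case: pselect => /= [_|_]; last exact: measurable0.
apply: (measurable_rV_box (fun i => ball (ratr (qk.1 ord0 i) : R) qk.2.+1%:R^-1)) => i.
exact: measurable_ball.
Qed.

Lemma continuous_measurable_rV (phi : rV -> R) :
  continuous phi -> measurable_fun setT phi.
Proof.
move=> cphi.
apply: (measurability (@RGenOInfty.G R)); first exact: RGenOInfty.measurableE.
move=> _ [_ [x ->] <-]; rewrite setTI; apply: open_measurable_rV.
by apply: open_comp => // y _; exact: cphi.
Qed.

Lemma bounded_subset_box (A : set rV) : bounded_set A ->
  exists2 K : R, 0 < K & A `<=` [set x | forall i, `[- K, K]%classic (rV_coord i x)].
Proof.
move=> [M [_ bM]]; exists (`|M| + 1); first by rewrite ltr_wpDl.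
move=> x Ax i; rewrite /= in_itv/= -ler_norml.
apply: le_trans (bM (`|M| + 1) _ x Ax); last by rewrite (le_lt_trans (ler_norm _))// ltrDl.
rewrite [leRHS]mx_normrE.
exact: (le_bigmax _ (fun ij => `|x ij.1 ij.2|) (ord0, i)).
Qed.

End rV_borel.

Section test_functions.
Context {R : realType} {n : nat}.
Local Notation rV := 'rV[R]_n.
Implicit Types (phi psi : rV -> R) (Omega : set rV).

Lemma partial_lin i k phi psi :
  (forall x, derivable (phi : rV -> R^o) x (delta_mx ord0 i)) ->
  (forall x, derivable (psi : rV -> R^o) x (delta_mx ord0 i)) ->
  partial i (fun x => k * phi x + psi x) =
  fun x => k * partial i phi x + partial i psi x.
Proof.
move=> dphi dpsi; apply/funext => x; rewrite /partial.
have dk : derivable (k \*: (phi : rV -> R^o)) x (delta_mx ord0 i).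
  exact: derivableZ.
have := @deriveD R rV R^o _ _ x (delta_mx ord0 i) dk (dpsi x).
by rewrite deriveZ//.
Qed.

Lemma smooth_foldr_partial_lin k phi psi : smooth phi -> smooth psi ->
  forall ds, foldr (@partial R n) (fun x => k * phi x + psi x) ds =
  fun x => k * foldr (@partial R n) phi ds x + foldr (@partial R n) psi ds x.
Proof.
move=> sphi spsi; elim=> //= i ds ->.
by rewrite partial_lin//; [exact: (sphi ds).2|exact: (spsi ds).2].
Qed.

Lemma smooth_lin k phi psi : smooth phi -> smooth psi ->
  smooth (fun x => k * phi x + psi x).
Proof.
move=> sphi spsi ds psi'; rewrite /psi' smooth_foldr_partial_lin//.
have [c1 d1] := sphi ds; have [c2 d2] := spsi ds; split.
  by move=> x; apply: (cvgD _ (c2 x)); exact: (cvgM (cvg_cst k) (c1 x)).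
move=> i x; apply: (@derivableD _ _ _ (k \*: (_ : rV -> R^o))); last exact: d2.
exact: derivableZ.
Qed.

Lemma smooth0 : smooth ((fun=> 0) : rV -> R).
Proof.
have foldr0 ds : foldr (@partial R n) (fun=> 0) ds = fun=> 0.
  elim: ds => //= i ds ->; apply/funext => x.
  exact: (@derive_cst R rV R^o 0).
move=> ds psi; rewrite /psi foldr0.
split=> [|i x]; first exact: cst_continuous.
exact: (@derivable_cst R rV R^o 0).
Qed.

Lemma test_function_lin_closed Omega : lin_closed (test_function Omega).
Proof.
split=> [|k phi psi [sphi cphi Ophi] [spsi cpsi Opsi]].
  have S0 : [set x : rV | (fun=> (0 : R)) x != 0] = set0.
    by apply/seteqP; split => x //=; rewrite eqxx.
  rewrite /test_function S0 closure0; split => //; first exact: smooth0.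
    exact: compact0.
have sub : closure [set x | k * phi x + psi x != 0] `<=`
    closure [set x | phi x != 0] `|` closure [set x | psi x != 0].
  rewrite -closureU; apply: closure_subset => x /=.
  have [->|] := eqVneq (phi x) 0; last by left.
  by rewrite mulr0 add0r; right.
split; first exact: smooth_lin.
  apply: (@subclosed_compact _ _ (closure [set x | phi x != 0] `|` closure [set x | psi x != 0])) => //.
    exact: closed_closure.
  exact: compactU.
by move=> x /sub[/Ophi|/Opsi].
Qed.

Lemma test_function_measurable Omega phi : test_function Omega phi ->
  measurable_fun setT phi.
Proof. by move=> [sphi _ _]; apply: continuous_measurable_rV; exact: (sphi [::]).1. Qed.

Lemma test_function_supp Omega phi x : test_function Omega phi ->
  ~ Omega x -> phi x = 0.
Proof.
move=> [_ _ sO] nO; apply/eqP/negP => /negP px; apply: nO; apply: sO.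
exact: subset_closure.
Qed.

End test_functions.

(** * The space H^s *)

Section gagliardo.
Context {R : realType} {n : nat}.
Local Notation rV := 'rV[R]_n.
Local Notation mu := (@lebesgue_rV R n).
Implicit Types (s : R) (u v w : rV -> R).

(* At [x = y] this is 0, as [0 `^ r = 0] for [r != 0]. *)
Definition diff_quotient s u (xy : rV * rV) : R :=
  (u xy.1 - u xy.2) * enorm (xy.1 - xy.2) `^ (- ((n%:R + 2 * s) / 2)).

Lemma enorm_powR_sq s (x : rV) :
  (enorm x `^ (- ((n%:R + 2 * s) / 2))) ^+ 2 = (enorm x `^ (n%:R + 2 * s))^-1.
Proof.
rewrite -powR_mulrn ?powR_ge0// -powRrM -powRN.
by rewrite (_ : _ * _ = - (n%:R + 2 * s))//; field.
Qed.

Lemma gagliardo_sqE s u :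
  gagliardo_sq s u = (\int[mu \x mu]_xy (diff_quotient s u xy ^+ 2)%:E)%E.
Proof.
by apply: eq_integral => xy _; rewrite /diff_quotient exprMn enorm_powR_sq.
Qed.

Lemma frac_formE s u v : frac_form s u v =
  @frac_const R n s / 2 * inner (mu \x mu)%E setT (diff_quotient s u) (diff_quotient s v).
Proof.
congr (_ * _); apply: eq_Rintegral => xy _.
by rewrite /diff_quotient -enorm_powR_sq; ring.
Qed.

Lemma diff_quotient_lin s k u v : diff_quotient s (fun x => k * u x + v x) =
  fun xy => k * diff_quotient s u xy + diff_quotient s v xy.
Proof. by apply/funext => xy; rewrite /diff_quotient; ring. Qed.

Lemma measurable_enormB :
  measurable_fun setT (fun xy : rV * rV => enorm (xy.1 - xy.2)).
Proof.
rewrite /enorm.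
apply: (@measurableT_comp _ _ _ _ _ _ (@Num.sqrt R)).
  by apply: continuous_measurable_fun; exact: sqrt_continuous.
apply: measurable_sum => i; apply: measurable_funX.
rewrite (_ : (fun _ => _) = fun xy : rV * rV => rV_coord i xy.1 - rV_coord i xy.2).
  by apply: measurable_funB; apply: measurableT_comp => //; exact: measurable_rV_coord.
by apply/funext => xy; rewrite !mxE.
Qed.

Lemma measurable_diff_quotient s u : measurable_fun setT u ->
  measurable_fun setT (diff_quotient s u).
Proof.
move=> mu'; apply: measurable_funM.
  by apply: measurable_funB; exact: measurableT_comp.
apply: (@measurableT_comp _ _ _ _ _ _ (@powR R ^~ _)) => //.
exact: measurable_enormB.
Qed.

Lemma HsP s u :
  Hs s u <-> sqint mu setT u /\ sqint (mu \x mu)%E setT (diff_quotient s u).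
Proof.
rewrite /Hs /= gagliardo_sqE; split=> [[Lu gu]|[Lu [_ gu]]]; split=> //.
by split=> //; apply: measurable_diff_quotient; exact: Lu.1.
Qed.

Definition Hs_form s u v : R :=
  inner mu setT u v + inner (mu \x mu)%E setT (diff_quotient s u) (diff_quotient s v).

Lemma Hs_lin_closed s : lin_closed (@Hs R n s).
Proof.
split.
  have q0 : diff_quotient s (fun=> 0) = fun=> 0.
    by apply/funext => xy; rewrite /diff_quotient subr0 mul0r.
  by apply/HsP; rewrite q0; split; exact: (sqint_lin_closed _ _ measurableT).1.
move=> k u v /HsP[Lu Gu] /HsP[Lv Gv]; apply/HsP; rewrite diff_quotient_lin.
by split; exact: (sqint_lin_closed _ _ measurableT).2.
Qed.

Lemma diff_quotient_form_psd s : psd_form (Hs s)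
  (fun u v => inner (mu \x mu)%E setT (diff_quotient s u) (diff_quotient s v)).
Proof.
have [sym lin ge0] := inner_psd (mu \x mu)%E setT measurableT.
split=> [u v /HsP[_ Gu] /HsP[_ Gv]|u /HsP[_ Gu] k v w /HsP[_ Gv] /HsP[_ Gw]|u /HsP[_ Gu]].
- exact: sym.
- by rewrite /= diff_quotient_lin; exact: lin.
- exact: ge0.
Qed.

Lemma Hs_form_psd s : psd_form (Hs s) (Hs_form s).
Proof.
have [symq linq geq] := diff_quotient_form_psd s.
have [sym lin ge0] := inner_psd mu setT measurableT.
split=> [u v Hu Hv|u Hu k v w Hv Hw|u Hu].
- have /HsP[Lu _] := Hu; have /HsP[Lv _] := Hv.
  by rewrite /Hs_form symq// sym.
- have /HsP[Lu _] := Hu; have /HsP[Lv _] := Hv; have /HsP[Lw _] := Hw.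
  have := linq u Hu k v w Hv Hw; have := lin u Lu k v w Lv Lw.
  by rewrite /Hs_form /= => -> ->; ring.
- have /HsP[Lu _] := Hu; by rewrite addr_ge0 ?ge0 ?geq.
Qed.

Lemma Hs_formE s u : Hs s u ->
  (Hs_form s u u)%:E = (\int[mu]_x (u x ^+ 2)%:E + gagliardo_sq s u)%E.
Proof.
move=> /HsP[Lu Gu].
by rewrite EFinD inner_sqE// inner_sqE// gagliardo_sqE.
Qed.

Lemma Hs_norm_formE s u : Hs s u ->
  Hs_norm s u = (Num.sqrt (Hs_form s u u))%:E.
Proof.
move=> Hu; rewrite /Hs_norm -Hs_formE// poweR_EFin powR12_sqrt//.
by have [_ _] := Hs_form_psd s; apply.
Qed.

Lemma Hs_norm_lty s u : measurable_fun setT u -> (Hs_norm s u < +oo)%E -> Hs s u.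
Proof.
move=> mu' /lty_poweRy H.
have u0 : (0 <= \int[mu]_x (u x ^+ 2)%:E)%E.
  by apply: integral_ge0 => x _; rewrite lee_fin sqr_ge0.
have g0 : (0 <= gagliardo_sq s u)%E.
  by rewrite gagliardo_sqE; apply: integral_ge0 => x _; rewrite lee_fin sqr_ge0.
have {}H : (\int[mu]_x (u x ^+ 2)%:E + gagliardo_sq s u < +oo)%E.
  by apply: H; rewrite invr_eq0 pnatr_eq0.
split; [split=> //|]; apply: le_lt_trans H.
  by rewrite leeDl.
by rewrite leeDr.
Qed.

(** [tHs] does not ask the approximating test functions to lie in [Hs], while [form_closure] does: a
    finite norm puts [u - phi] in [Hs], hence also [phi]. *)
Lemma tHsE s Omega :
  tHs s Omega = form_closure (Hs s) (test_function Omega) (Hs_form s).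
Proof.
have [_ _ B0] := Hs_form_psd s.
apply/seteqP; split=> u [Hu cu]; split=> // e e0.
- have s0 : 0 < Num.sqrt e by rewrite sqrtr_gt0.
  have [phi tphi uphi] := cu _ s0.
  have mphi := test_function_measurable _ _ tphi.
  have Hd : Hs s (fun x => u x - phi x).
    apply: Hs_norm_lty; first by apply: measurable_funB => //; exact: Hu.1.1.
    exact: lt_trans uphi (ltry _).
  exists phi.
    split=> //; rewrite (_ : phi = fun x => u x - (u x - phi x)).
      exact: (lin_closedB (Hs_lin_closed s)).
    by apply/funext => x; rewrite subKr.
  move: uphi; rewrite [Hs_norm _ _](Hs_norm_formE _ _ Hd) lte_fin ltr_sqrt//.
- have [phi [Hphi tphi] uphi] := cu _ (exprn_gt0 2 e0).
  exists phi => //.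
  have Hd : Hs s (fun x => u x - phi x) by exact: (lin_closedB (Hs_lin_closed s)).
  rewrite [Hs_norm _ _](Hs_norm_formE _ _ Hd) lte_fin.
  by rewrite -(ger0_norm (ltW e0)) -sqrtr_sqr ltr_sqrt// exprn_gt0.
Qed.

(** The exceptional set lies in a union of two strips over a null set, null because 0 times +oo is
    0. This carries convergence of functions over to their difference quotients. *)
Lemma ae_prod (P : rV -> Prop) : {ae mu, forall x, P x} ->
  {ae (mu \x mu)%E, forall xy, P xy.1 /\ P xy.2}.
Proof.
move=> [N [mN N0 PN]].
have mu2 (A B : set rV) : measurable A -> measurable B ->
    (mu A * mu B = 0)%E -> (mu \x mu)%E.-negligible (A `*` B).
  move=> mA mB AB0; exists (A `*` B); split => //; first exact: measurableX.
  by rewrite product_measure1E.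
apply: (@negligibleS _ _ _ _ ((N `*` setT) `|` (setT `*` N))).
  by move=> [x y] /= /not_andP[nP|nP]; [left|right]; split=> //; exact: PN.
by apply: negligibleU; apply: mu2; rewrite // N0 ?mul0e ?mule0.
Qed.

Lemma Hs_form_ge s u : Hs s u ->
  (\int[mu]_x (u x ^+ 2)%:E <= (Hs_form s u u)%:E)%E /\
  (\int[mu \x mu]_xy (diff_quotient s u xy ^+ 2)%:E <= (Hs_form s u u)%:E)%E.
Proof.
move=> Hu; rewrite Hs_formE// gagliardo_sqE; split.
  by rewrite leeDl//; apply: integral_ge0 => x _; rewrite lee_fin sqr_ge0.
by rewrite leeDr//; apply: integral_ge0 => x _; rewrite lee_fin sqr_ge0.
Qed.

(** Fatou applied to the tails [us (j + k) - us k], separately for the function and for its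
    difference quotient; each contributes [C * 4 ^- k], whence the factor 2. *)
Lemma Hs_complete s (C : R) (us : nat -> rV -> R) : (forall k, Hs s (us k)) ->
  (forall k j, (k <= j)%N ->
    Hs_form s (fun x => us j x - us k x) (fun x => us j x - us k x) <= C * 4 ^- k) ->
  exists2 u, Hs s u & forall k,
    Hs_form s (fun x => u x - us k x) (fun x => u x - us k x) <= 2 * C * 4 ^- k.
Proof.
move=> Hus cus; have Hlin := Hs_lin_closed s.
have mus k : measurable_fun setT (us k) by exact: (Hus k).1.1.
have Hd j k : Hs s (fun x => us j x - us k x) by exact: (lin_closedB Hlin).
(* The upper limit is measurable and defined everywhere; it equals the limit wherever a finite one
   exists. *)
pose u x := fine (limn_esup (fun k => (us k x)%:E)).
have mU : measurable_fun setT u.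
  apply: measurableT_comp => //; apply: measurable_fun_limn_esup => k.
  exact/measurable_EFinP.
have usu : {ae mu, forall x, us^~ x @ \oo --> u x}.
  have := @ae_cvg_of_fast_cauchy _ _ _ mu C us mus.
  case=> [j|N [mN N0 cN]].
    apply: le_trans (Hs_form_ge _ _ (Hd j.+1 j)).1 _.
    by rewrite lee_fin; exact: cus.
  exists N; split=> //; apply: subset_trans cN; apply: subsetC => x /= /cvg_ex[l cl].
  have cle : (fun k => (us k x)%:E) @ \oo --> l%:E by apply: cvg_EFin => //; exact: nearW.
  by rewrite /u (cvg_limn_einf_sup cle).2.
have bL k : (\int[mu]_x ((u x - us k x) ^+ 2)%:E <= (C * 4 ^- k)%:E)%E.
  apply: (sq_fatou mu (fun j x => us (j + k)%N x - us k x)).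
  - by move=> j; exact: (Hd _ _).1.1.
  - exact: measurable_funB.
  - apply: filterS usu => x ux; apply: cvgB; last exact: cvg_cst.
    by rewrite (cvg_shiftn k (us^~ x)).
  - move=> j; apply: le_trans (Hs_form_ge _ _ (Hd (j + k)%N k)).1 _.
    by rewrite lee_fin; apply: cus; rewrite leq_addl.
have bG k : (\int[mu \x mu]_xy (diff_quotient s (fun x => u x - us k x) xy ^+ 2)%:E <=
    (C * 4 ^- k)%:E)%E.
  apply: (sq_fatou _ (fun j => diff_quotient s (fun x => us (j + k)%N x - us k x))).
  - by move=> j; apply: measurable_diff_quotient; exact: (Hd _ _).1.1.
  - by apply: measurable_diff_quotient; exact: measurable_funB.
  - apply: filterS (ae_prod _ usu) => -[x y] /= [ux uy].
    have cB z : us^~ z @ \oo --> u z ->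
        (fun j => us (j + k)%N z - us k z) @ \oo --> u z - us k z.
      move=> uz; apply: cvgB; last exact: cvg_cst.
      by rewrite (cvg_shiftn k (us^~ z)).
    by apply: cvgMl; apply: cvgB; exact: cB.
  - move=> j; apply: le_trans (Hs_form_ge _ _ (Hd (j + k)%N k)).2 _.
    by rewrite lee_fin; apply: cus; rewrite leq_addl.
have Hud k : Hs s (fun x => u x - us k x).
  apply/HsP; split; split.
  - exact: measurable_funB.
  - exact: le_lt_trans (bL k) (ltry _).
  - by apply: measurable_diff_quotient; exact: measurable_funB.
  - exact: le_lt_trans (bG k) (ltry _).
exists u.
  rewrite (_ : u = fun x => (u x - us 0%N x) - (- 1 * us 0%N x)).
    by apply: (lin_closedB Hlin) => //; exact: lin_closedZ.
  by apply/funext => x; ring.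
move=> k; rewrite -lee_fin Hs_formE// gagliardo_sqE.
rewrite (_ : 2 * C * 4 ^- k = C * 4 ^- k + C * 4 ^- k); last by ring.
by rewrite EFinD leeD.
Qed.
End gagliardo.

(** * Poincare inequality *)

Section poincare.
Context {R : realType} {n : nat}.
Local Notation rV := 'rV[R]_n.
Local Notation mu := (@lebesgue_rV R n).
Implicit Types (s : R) (u v w : rV -> R) (Omega Q : set rV).

Lemma tHs_Hs s Omega v : tHs s Omega v -> Hs s v.
Proof. by case. Qed.

(** Off [Q] the test functions vanish, so there [v] coincides with its difference from them, whose
    norm is arbitrarily small. *)
Lemma tHs_null_outside s Omega Q v : measurable Q -> Omega `<=` Q ->
  tHs s Omega v -> (\int[mu]_(x in ~` Q) (v x ^+ 2)%:E = 0)%E.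
Proof.
move=> mQ OQ; rewrite tHsE => -[Hv cv].
have mQc : measurable (~` Q) by exact: measurableC.
apply/eqP; rewrite eq_le; apply/andP; split; last first.
  by apply: integral_ge0 => x _; rewrite lee_fin sqr_ge0.
apply/lee_addgt0Pr => e e0; rewrite add0e.
have [phi [Hphi tphi] vphi] := cv _ e0.
have Hd : Hs s (fun x => v x - phi x) by exact: (lin_closedB (Hs_lin_closed s)).
apply: (@le_trans _ _ (\int[mu]_x ((v x - phi x) ^+ 2)%:E)%E); last first.
  by apply: le_trans (Hs_form_ge _ _ Hd).1 _; rewrite lee_fin ltW.
rewrite (eq_integral (fun x => ((v x - phi x) ^+ 2)%:E)); last first.
  move=> x /set_mem xQ; rewrite (test_function_supp _ _ _ tphi) ?subr0//.
  by move=> /OQ.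
apply: ge0_subset_integral => //.
- by apply: measurable_sq; exact: Hd.1.1.
- by move=> x _; rewrite lee_fin sqr_ge0.
Qed.

Lemma enorm_le (x : rV) (M : R) : 0 <= M -> (forall i, `|x ord0 i| <= M) ->
  enorm x <= Num.sqrt (n%:R * M ^+ 2).
Proof.
move=> M0 xM; apply: ler_wsqrtr; rewrite mulr_natl -[n in leRHS]card_ord -sumr_const.
by apply: ler_sum => i _; rewrite -(real_normK (num_real _)) lerXn2r// nnegrE.
Qed.

Lemma enorm_gt0 (x : rV) i : x ord0 i != 0 -> 0 < enorm x.
Proof.
move=> xi; rewrite sqrtr_gt0 (bigD1 i)//= ltr_wpDr//.
  by apply: sumr_ge0 => j _; exact: sqr_ge0.
by rewrite lt_def sqr_ge0 andbT sqrf_eq0.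
Qed.

(* For [x] in a box [Q] containing [Omega] and [y] in a disjoint unit box [P],
   [v x = v x - v y] for almost every [y], while the kernel is bounded below on
   [Q * P]. *)
Lemma poincare s Omega : (1 <= n)%N -> 0 < s -> bounded_set Omega ->
  exists2 C : R, 0 <= C & forall v, tHs s Omega v ->
    inner mu setT v v <= C * inner (mu \x mu)%E setT (diff_quotient s v) (diff_quotient s v).
Proof.
move=> n1 s0 /bounded_subset_box[K K0 OQ].
set Q : set rV := mkset _ in OQ.
pose P : set rV := [set x | forall i, `[K + 1, K + 2]%classic (rV_coord i x)].
have mQ : measurable Q.
  by apply: (@measurable_rV_box R n (fun=> `[- K, K]%classic)) => i; exact: measurable_itv.
have mP : measurable P.
  by apply: (@measurable_rV_box R n (fun=> `[K + 1, K + 2]%classic)) => i; exact: measurable_itv.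
have PQ : P `<=` ~` Q.
  (* Any one coordinate separates the boxes; [n1] provides it. *)
  move=> x Px Qx; have := Px (Ordinal n1); have := Qx (Ordinal n1).
  by rewrite /= !in_itv/= => /andP[_ xK] /andP[Kx _]; lra.
have muP : mu P = 1%E.
  rewrite (@lebesgue_rV_box R n (fun=> `[K + 1, K + 2]%classic)); last first.
    by move=> i; exact: measurable_itv.
  rewrite big1// => i _; rewrite lebesgue_measure_itv/= lte_fin.
  by rewrite ltrD2l ltr1n -EFinD; congr EFin; ring.
(* For [x] in [Q] and [y] in [P] every coordinate of [x - y] is at most [2 * K + 2] in size, so [M]
   bounds [enorm (x - y)] to the power [n + 2 * s]. *)
pose M : R := Num.sqrt (n%:R * (2 * K + 2) ^+ 2) `^ (n%:R + 2 * s).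
have p0 : 0 < n%:R + 2 * s by rewrite ltr_wpDl// mulr_gt0.
have ker x y : Q x -> P y -> forall v,
    (v x - v y) ^+ 2 <= M * diff_quotient s v (x, y) ^+ 2.
  move=> Qx Py v; rewrite exprMn enorm_powR_sq /= mulrCA ler_peMr ?sqr_ge0//.
  have xy0 : 0 < enorm (x - y).
    apply: (@enorm_gt0 _ (Ordinal n1)); rewrite !mxE.
    have := Qx (Ordinal n1); have := Py (Ordinal n1).
    rewrite /= !in_itv/= /rV_coord => /andP[yK _] /andP[_ xK].
    by rewrite subr_eq0 lt_eqF//; lra.
  rewrite ler_pdivlMr ?powR_gt0// mul1r.
  apply: ge0_ler_powR; rewrite ?nnegrE ?sqrtr_ge0// ?(ltW p0)//.
  apply: enorm_le => [|i]; first lra.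
  rewrite !mxE ler_norml; have := Qx i; have := Py i.
  rewrite /= !in_itv/= /rV_coord => /andP[? ?] /andP[? ?].
  by apply/andP; split; lra.
have M0 : 0 <= M by exact: powR_ge0.
exists (2 * M); first by rewrite mulr_ge0.
move=> v tv; have Hv := tHs_Hs _ _ _ tv; have /HsP[Lv Gv] := Hv.
have vQ := tHs_null_outside _ _ _ _ mQ OQ tv.
rewrite -lee_fin EFinM !inner_sqE//.
have mv2 D : measurable_fun D (fun x => (v x ^+ 2)%:E).
  by apply: measurable_funTS; apply: measurable_sq; exact: Lv.1.
have v20 D : (0 <= \int[mu]_(x in D) (v x ^+ 2)%:E)%E.
  by apply: integral_ge0 => x _; rewrite lee_fin sqr_ge0.
have vP : (\int[mu]_(x in P) (v x ^+ 2)%:E = 0)%E.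
  apply/eqP; rewrite eq_le v20 andbT -vQ.
  apply: ge0_subset_integral => //; first exact: measurableC.
  by move=> x _; rewrite lee_fin sqr_ge0.
pose q2 xy := (diff_quotient s v xy ^+ 2)%:E.
have q20 xy : (0 <= q2 xy)%E by rewrite lee_fin sqr_ge0.
have mq2 : measurable_fun setT q2 by apply: measurable_sq; exact: Gv.1.
have mq2x x D : measurable_fun D (fun y => q2 (x, y)).
  apply: measurable_funTS; apply: (measurableT_comp mq2).
  exact: measurable_fun_pair.
have key x : Q x -> ((v x ^+ 2)%:E <= (2 * M)%:E * fubini_F mu q2 x)%E.
  move=> Qx.
  apply: (@le_trans _ _ ((2 * M)%:E * \int[mu]_(y in P) q2 (x, y))%E); last first.
    apply: lee_wpmul2l; first by rewrite lee_fin mulr_ge0.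
    exact: ge0_subset_integral.
  rewrite -ge0_integralZl_EFin//; last by rewrite mulr_ge0.
  (* As [P] has volume 1, [v x ^+ 2] is its own integral over [y] in [P]; then
     [a ^+ 2 <= 2 * (a - b) ^+ 2 + 2 * b ^+ 2] with [a = v x] and [b = v y], where the last term
     integrates to 0. *)
  rewrite -[leLHS]mule1 -muP -integral_cst//.
  apply: (@le_trans _ _ (\int[mu]_(y in P) ((2 * M)%:E * q2 (x, y) + 2%:E * (v y ^+ 2)%:E))%E).
    apply: ge0_le_integral => //.
    - by move=> y _; rewrite lee_fin sqr_ge0.
    - by apply: emeasurable_funD; exact: measurable_funeM.
    - move=> y Py; rewrite /q2 -!EFinM -EFinD lee_fin.
      have := ker x y Qx Py v; have := sqr_ge0 (v x - 2 * v y); nra.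
  rewrite ge0_integralD//; last 4 first.
  - by move=> y _; rewrite mule_ge0// lee_fin mulr_ge0.
  - exact: measurable_funeM.
  - by move=> y _; rewrite -EFinM lee_fin mulr_ge0// sqr_ge0.
  - exact: measurable_funeM.
  rewrite [X in (_ + X)%E]ge0_integralZl_EFin// ?vP ?mule0 ?adde0//.
  by move=> y _; rewrite lee_fin sqr_ge0.
have -> : (\int[mu]_x (v x ^+ 2)%:E = \int[mu]_(x in Q) (v x ^+ 2)%:E)%E.
  rewrite -(setUv Q) ge0_integral_setU//.
  - by rewrite [X in (_ + X)%E]vQ adde0.
  - exact: measurableC.
  - by move=> x _; rewrite lee_fin sqr_ge0.
  by apply/disj_setPCl.
have -> := @fubini_tonelli1 _ _ _ _ R mu mu q2 mq2 q20.
have mF : measurable_fun setT (fubini_F mu q2) by exact: measurable_fun_fubini_tonelli_F.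
have F0 x : (0 <= fubini_F mu q2 x)%E by exact: integral_ge0.
rewrite -ge0_integralZl_EFin//; last by rewrite mulr_ge0.
apply: (@le_trans _ _ (\int[mu]_(x in Q) ((2 * M)%:E * fubini_F mu q2 x))%E).
  apply: ge0_le_integral => //.
  - by move=> x _; rewrite lee_fin sqr_ge0.
  - by apply: measurable_funTS; exact: measurable_funeM.
apply: ge0_subset_integral => //; first exact: measurable_funeM.
by move=> x _; rewrite mule_ge0// lee_fin mulr_ge0.
Qed.

End poincare.

(** * States, adjoint states and the cost *)

Section solutions.
Context {R : realType} {n : nat} {s : R} {Omega : set 'rV[R]_n}.
Local Notation rV := 'rV[R]_n.
Local Notation mu := (@lebesgue_rV R n).
Local Notation A := (@frac_form R n s).
Local Notation V := (tHs s Omega).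
Local Notation ip := (@L2_inner R n Omega).
Implicit Types (u v w z p ud : rV -> R).
Hypotheses (n1 : (1 <= n)%N) (s0 : 0 < s) (s1 : s < 1).
Hypotheses (bO : bounded_set Omega) (oO : open Omega).

Lemma tHs_lin_closed : lin_closed V.
Proof.
rewrite tHsE; apply: form_closure_lin_closed.
- exact: Hs_lin_closed.
- exact: test_function_lin_closed.
- exact: Hs_form_psd.
Qed.

Let c0 : 0 < @frac_const R n s / 2.
Proof. by rewrite divr_gt0// frac_const_gt0. Qed.

Lemma frac_form_psd : psd_form (Hs s) A.
Proof.
have [symq linq geq] := @diff_quotient_form_psd R n s.
split=> [u v Hu Hv|u Hu k v w Hv Hw|u Hu].
- by rewrite !frac_formE symq.
- by rewrite /= !frac_formE linq// mulrDr mulrCA.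
- by rewrite frac_formE mulr_ge0 ?geq// ltW.
Qed.

Lemma frac_form_psd_tHs : psd_form V A.
Proof.
have [sym lin ge0] := frac_form_psd.
split=> [u v [Hu _] [Hv _]|u [Hu _] k v w [Hv _] [Hw _]|u [Hu _]].
- exact: sym.
- exact: lin.
- exact: ge0.
Qed.

Lemma frac_form_le u : Hs s u -> A u u <= @frac_const R n s / 2 * Hs_form s u u.
Proof.
move=> /HsP[Lu Gu]; rewrite frac_formE ler_wpM2l ?(ltW c0)// lerDr.
by have [_ _] := inner_psd mu setT measurableT; apply.
Qed.

Lemma frac_form_coercive :
  exists2 C : R, 0 <= C & forall v, V v -> Hs_form s v v <= C * A v v.
Proof.
have [C C0 CP] := poincare s Omega n1 s0 bO.
(* The L^2 part costs [C] and the difference quotient part 1; the division undoes the factor in the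
   energy. *)
exists ((C + 1) / (@frac_const R n s / 2)).
  by rewrite divr_ge0 ?(ltW c0)// addr_ge0.
move=> v Vv; rewrite frac_formE mulrA divfK ?gt_eqF//.
have := CP v Vv; rewrite /Hs_form; lra.
Qed.

(** Completeness is borrowed from [Hs]: coercivity turns energy increments into [Hs] increments,
    [tHs] is closed there, and continuity of the energy brings the convergence back. *)
Lemma frac_form_solution F (C : R) : 0 <= C -> linear_on V F ->
  (forall v, V v -> F v ^+ 2 <= C * Hs_form s v v) ->
  exists2 u, V u & forall v, V v -> A u v = F v.
Proof.
move=> C0 linF bF; have [K K0 KP] := frac_form_coercive.
have Hlin := @Hs_lin_closed R n s; have Hpsd := @Hs_form_psd R n s.
apply: (riesz_representation tHs_lin_closed frac_form_psd_tHs F (C * K)) => //.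
- exact: mulr_ge0.
- by move=> v Vv; apply: le_trans (bF v Vv) _; rewrite -mulrA ler_wpM2l// KP.
move=> us Vus cus.
have Vd j k : V (fun x => us j x - us k x) by exact: (lin_closedB tHs_lin_closed).
have Hus k : Hs s (us k) by exact: (Vus k).1.
have [u Hu uus] : exists2 u, Hs s u & forall k,
    Hs_form s (fun x => u x - us k x) (fun x => u x - us k x) <= 2 * K * 4 ^- k.
  apply: Hs_complete => // k j kj; apply: le_trans (KP _ (Vd j k)) _.
  by rewrite ler_wpM2l// cus.
exists u.
  rewrite tHsE; apply: form_closure_closed => // e e0.
  have [k ke] : exists k, 2 * K * 4 ^- k < e.
    apply: contrapT => /forallNP H; have : e <= 0.
      apply: (@geometric_le0 _ (2 * K)) => k.
      by rewrite leNgt; apply/negP; exact: H.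
    by rewrite leNgt e0.
  exists (us k); last exact: le_lt_trans (uus k) ke.
  by rewrite -tHsE.
exists (@frac_const R n s / 2 * (2 * K)) => k.
have Hk : Hs s (fun x => u x - us k x) by exact: (lin_closedB Hlin).
apply: le_trans (frac_form_le _ Hk) _.
by rewrite -[leRHS]mulrA ler_wpM2l ?(ltW c0)// uus.
Qed.

Let mO : measurable Omega.
Proof. exact: open_measurable_rV. Qed.

Lemma tHs_L2 v : V v -> L2 Omega v.
Proof.
move=> [[[mv Lv] _] _]; split; first exact: measurable_funTS.
apply: le_lt_trans Lv; apply: ge0_subset_integral => //.
- exact: measurable_sq.
- by move=> x _; rewrite lee_fin sqr_ge0.
Qed.

Lemma L2_inner_le_Hs_form v : V v -> ip v v <= Hs_form s v v.
Proof.
move=> Vv; have Hv : Hs s v by case: Vv.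
rewrite -lee_fin; apply: le_trans (Hs_form_ge _ _ Hv).1.
rewrite (inner_sqE mu Omega _ (tHs_L2 _ Vv)).
apply: ge0_subset_integral => //.
- by apply: measurable_sq; exact: Hv.1.1.
- by move=> x _; rewrite lee_fin sqr_ge0.
Qed.

Lemma weak_solution f z : dual_tHs s Omega f -> L2 Omega z ->
  exists u, is_state s Omega f z u.
Proof.
move=> [linf [C fC]] Lz.
have L2lin := sqint_lin_closed mu Omega mO; have L2psd := inner_psd mu Omega mO.
have [u Vu uP] : exists2 u, V u & forall v, V v -> A u v = f v + ip z v.
  have zz : 0 <= ip z z by have [_ _] := L2psd; apply.
  (* From [(f v + ip z v) ^+ 2 <= 2 * f v ^+ 2 + 2 * ip z v ^+ 2]. *)
  apply: (@frac_form_solution _ (2 * C ^+ 2 + 2 * ip z z)).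
  - by rewrite addr_ge0// mulr_ge0// sqr_ge0.
  - move=> k v w Vv Vw; rewrite linf//.
    have := inner_linear mu Omega mO z Lz k v w (tHs_L2 _ Vv) (tHs_L2 _ Vw).
    rewrite /= -![inner _ _ _ z](inner_sym _ _ z) => zvw.
    by rewrite [ip z _]zvw /L2_inner /inner; ring.
  - move=> v Vv; have Hv : Hs s v by case: Vv.
    have h0 : 0 <= Hs_form s v v by have [_ _] := @Hs_form_psd R n s; apply.
    (* [C] carries no sign; [C * Hs_norm s v] is nonnegative because it bounds [|f v|]. *)
    have f2 : f v ^+ 2 <= C ^+ 2 * Hs_form s v v.
      have := fC v Vv; rewrite Hs_norm_formE// -EFinM lee_fin => fv.
      rewrite -(real_normK (num_real (f v))) -[X in _ * X]sqr_sqrtr// -exprMn.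
      by rewrite lerXn2r// nnegrE// (le_trans _ fv).
    have z2 : ip z v ^+ 2 <= ip z z * Hs_form s v v.
      apply: le_trans (form_CauchySchwarz L2lin L2psd _ _ Lz (tHs_L2 _ Vv)) _.
      by rewrite ler_wpM2l// L2_inner_le_Hs_form.
    by have := sqr_ge0 (f v - ip z v); lra.
by exists u.
Qed.

Lemma control_to_stateP f z : dual_tHs s Omega f -> L2 Omega z ->
  is_state s Omega f z (control_to_state s Omega f z).
Proof.
move=> df Lz; have [u uP] := weak_solution _ _ df Lz.
by apply: (@getPex _ [set u | is_state s Omega f z u]); exists u.
Qed.

(** By symmetry of the form, the adjoint equation is a state equation with zero functional and
    source [u - ud]. *)
Lemma adjoint_stateP ud u : L2 Omega ud -> L2 Omega u ->
  is_adjoint_state s Omega ud u (adjoint_state s Omega ud u).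
Proof.
move=> Lud Lu.
have [||p [Vp pP]] := weak_solution (fun=> 0) (u \- ud).
- split; first by move=> k v w _ _; rewrite mulr0 addr0.
  by exists 0 => v _; rewrite normr0 mul0e.
- exact: (lin_closedB (sqint_lin_closed mu Omega mO)).
apply: (@getPex _ [set p | is_adjoint_state s Omega ud u p]); exists p.
split=> // v Vv; have [sym _ _] := frac_form_psd_tHs.
by rewrite sym// pP// add0r.
Qed.

Lemma costE ud alpha u z : L2 Omega ud -> L2 Omega u -> L2 Omega z ->
  cost Omega ud alpha u z =
  2^-1 * ip (fun x => u x - ud x) (fun x => u x - ud x) + alpha / 2 * ip z z.
Proof.
move=> Lud Lu Lz; have [_ _ ge0] := inner_psd mu Omega mO.
rewrite /cost /L2_norm !sqr_sqrtr//; first exact: ge0.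
by apply: ge0; apply: (lin_closedB (sqint_lin_closed mu Omega mO)).
Qed.

(* The adjoint equation tested with [w = S z - S zbar] turns the linear part
   [(S zbar - ud, w)] of the cost into [(p, z - zbar)]. *)
Lemma cost_expansion f ud alpha z zbar (u := control_to_state s Omega f z)
    (ubar := control_to_state s Omega f zbar)
    (h := fun x => z x - zbar x) (w := fun x => u x - ubar x) :
  dual_tHs s Omega f -> L2 Omega ud -> L2 Omega z -> L2 Omega zbar ->
  cost Omega ud alpha u z = cost Omega ud alpha ubar zbar +
    ip (fun x => adjoint_state s Omega ud ubar x + alpha * zbar x) h +
    (2^-1 * ip w w + alpha / 2 * ip h h).
Proof.
move=> df Lud Lz Lzb.
have L2lin := sqint_lin_closed mu Omega mO.
have L2psd := inner_psd mu Omega mO; have [sym lin ge0] := L2psd.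
have [Vu uP] := control_to_stateP _ _ df Lz.
have [Vub ubP] := control_to_stateP _ _ df Lzb.
have Lu := tHs_L2 _ Vu; have Lub := tHs_L2 _ Vub.
have [Vp pP] := adjoint_stateP _ _ Lud Lub.
rewrite -/u -/ubar in Vu uP Vub ubP Lu Lub Vp pP *.
set p := adjoint_state s Omega ud ubar in Vp pP *.
have Lp := tHs_L2 _ Vp.
have Lh : L2 Omega h by exact: (lin_closedB L2lin).
have Vw : V w by exact: (lin_closedB tHs_lin_closed).
have Lw := tHs_L2 _ Vw.
have Ld : L2 Omega (fun x => ubar x - ud x) by exact: (lin_closedB L2lin).
have wp : ip (fun x => ubar x - ud x) w = ip p h.
  have := pP _ Vw; rewrite /= => <-.
  have [_ linA _] := frac_form_psd_tHs.
  have /= -> := linear_onB _ _ _ (linA _ Vp) Vu Vub.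
  rewrite uP// ubP//.
  have /= := linear_onB _ _ _ (lin _ Lp) Lz Lzb.
  rewrite [inner _ _ _ p]inner_sym -/h => hp.
  by rewrite [ip p h]hp /L2_inner /inner; ring.
have -> : ip (fun x => p x + alpha * zbar x) h = ip p h + alpha * ip zbar h.
  have /= := lin _ Lh alpha zbar p Lzb Lp.
  rewrite (_ : (fun x => alpha * zbar x + p x) = fun x => p x + alpha * zbar x).
    by rewrite addrC.
  by apply/funext => x; rewrite addrC.
rewrite !costE//.
have -> : (fun x => u x - ud x) = fun x => 1 * w x + (ubar x - ud x).
  by apply/funext => x; rewrite /w; ring.
have -> : ip z z = ip (fun x => 1 * h x + zbar x) (fun x => 1 * h x + zbar x).
  by congr (ip _ _); apply/funext => x; rewrite /h; ring.
have ww := form_expand L2lin L2psd 1 _ _ Lw Ld.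
have hh := form_expand L2lin L2psd 1 _ _ Lh Lzb.
rewrite [ip (fun x => 1 * w x + _) _]ww [ip (fun x => 1 * h x + _) _]hh -wp.
by rewrite (sym _ _ Lw Ld) (sym _ _ Lh Lzb) /L2_inner /inner; field.
Qed.

(** Testing the difference of the state equations with [w] gives [ip w w <= C * ip h w], and
    Cauchy-Schwarz cancels one factor. [K] is uniform in the controls, so it serves for every [t]
    along a segment. *)
Lemma state_stability : exists2 K : R, 0 <= K & forall f z zbar
    (w := fun x => control_to_state s Omega f z x - control_to_state s Omega f zbar x)
    (h := fun x => z x - zbar x),
  dual_tHs s Omega f -> L2 Omega z -> L2 Omega zbar -> ip w w <= K * ip h h.
Proof.
have [C C0 CP] := frac_form_coercive.
exists (C ^+ 2); first exact: sqr_ge0.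
move=> f z zbar w h df Lz Lzb.
have L2lin := sqint_lin_closed mu Omega mO.
have L2psd := inner_psd mu Omega mO; have [sym lin ge0] := L2psd.
have [Vu uP] := control_to_stateP _ _ df Lz.
have [Vub ubP] := control_to_stateP _ _ df Lzb.
have Lh : L2 Omega h by exact: (lin_closedB L2lin).
have Vw : V w by exact: (lin_closedB tHs_lin_closed).
have Lw := tHs_L2 _ Vw.
have Aw : A w w = ip h w.
  have [_ linA _] := frac_form_psd_tHs.
  have /= -> := linear_onB _ _ _ (linA _ Vw) Vu Vub.
  rewrite uP// ubP//; have /= := linear_onB _ _ _ (lin _ Lw) Lz Lzb.
  by rewrite -/h => hw; rewrite [ip h w]hw /L2_inner /inner; ring.
have wC : ip w w <= C * ip h w.
  rewrite -Aw; apply: le_trans (CP _ Vw); exact: L2_inner_le_Hs_form.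
have CS := form_CauchySchwarz L2lin L2psd _ _ Lh Lw.
have w0 := ge0 _ Lw; have h0 := ge0 _ Lh.
rewrite /L2_inner -/(inner mu Omega w w) -/(inner mu Omega h h)
  -/(inner mu Omega h w) in wC *.
have [->|wn0] := eqVneq (inner mu Omega w w) 0; first by rewrite mulr_ge0// sqr_ge0.
have wp : 0 < inner mu Omega w w by rewrite lt_def wn0.
(* Multiplying by [ip w w] reduces the claim to a comparison of squares, with no square root
   extracted. *)
rewrite -(ler_pM2r wp) -mulrA -expr2.
apply: (@le_trans _ _ ((C * inner mu Omega h w) ^+ 2)).
  by rewrite lerXn2r// nnegrE// (le_trans _ wC).
by rewrite exprMn ler_wpM2l// sqr_ge0.
Qed.

End solutions.

(** * First-order optimality condition *)

Lemma ge0_of_quadratic_ge0 (R : realFieldType) (D N : R) : 0 <= N ->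
  (forall t, 0 < t -> t <= 1 -> 0 <= t * D + t ^+ 2 * N) -> 0 <= D.
Proof.
move=> N0 H; rewrite leNgt; apply/negP => D0.
have ND : 0 < N - D by lra.
(* With [D < 0] this [t] lies in (0, 1] for every [N >= 0], and the value there is
   [D ^+ 3 / (N - D) ^+ 2], which is negative; the minimiser [- D / (2 * N)] could exceed 1. *)
have t0 : 0 < - D / (N - D) by rewrite divr_gt0// oppr_gt0.
have t1 : - D / (N - D) <= 1 by rewrite ler_pdivrMr// mul1r; lra.
have := H _ t0 t1.
have -> : - D / (N - D) * D + (- D / (N - D)) ^+ 2 * N = D ^+ 3 / (N - D) ^+ 2.
  by field; lra.
rewrite pmulr_lge0 ?invr_gt0 ?exprn_gt0// exprSr.
by rewrite nmulr_lge0// leNgt => /negP; apply; rewrite exprn_even_gt0//= lt_eqF.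
Qed.

Lemma admissible_convex (R : realType) (n : nat) (a b t : R)
    (Omega : set 'rV[R]_n) (z zbar : 'rV[R]_n -> R) : measurable Omega ->
  0 <= t -> t <= 1 -> admissible Omega a b z -> admissible Omega a b zbar ->
  admissible Omega a b (fun x => t * (z x - zbar x) + zbar x).
Proof.
move=> mO t0 t1 [Lz az] [Lzb azb].
have L2lin := sqint_lin_closed (@lebesgue_rV R n) Omega mO.
split; first by apply: L2lin.2 => //; exact: (lin_closedB L2lin).
apply: filterS2 az azb => x zP zbP Ox.
have /andP[az bz] := zP Ox; have /andP[azb bzb] := zbP Ox.
apply/andP; split; nra.
Qed.

Theorem theorem2 (R : realType) (n : nat) (s alpha a b : R)
    (Omega : set 'rV[R]_n) (f : ('rV[R]_n -> R) -> R)
    (ud zbar : 'rV[R]_n -> R) :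
  (1 <= n)%N ->
  bounded_domain Omega -> lipschitz_boundary Omega ->
  exterior_ball_condition Omega ->
  0 < s -> s < 1 -> 0 < alpha -> a < b ->
  dual_tHs s Omega f -> L2 Omega ud ->
  admissible Omega a b zbar ->
  let ubar := control_to_state s Omega f zbar in
  let pbar := adjoint_state s Omega ud ubar in
  optimal_control s Omega f ud alpha a b zbar <->
  (forall z, admissible Omega a b z ->
     0 <= L2_inner Omega (fun x => pbar x + alpha * zbar x)
                         (fun x => z x - zbar x)).
Proof.
move=> n1 [oO _ _ bO] _ _ s0 s1 alpha0 _ df Lud azb ubar pbar.
have mO : measurable Omega by exact: open_measurable_rV.
have [_ _ ge0] := inner_psd (@lebesgue_rV R n) Omega mO.
have ip0 w : 0 <= L2_inner Omega w w.
  by apply: Rintegral_ge0 => x _; rewrite -expr2 sqr_ge0.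
have Lzb := azb.1.
have expansion z (Lz : L2 Omega z) := cost_expansion n1 s0 s1 bO oO _ _ alpha _ _ df Lud Lz Lzb.
split=> [[_ opt] z az|VI].
- have Lz := az.1.
  have [K K0 KP] := state_stability n1 s0 s1 bO oO.
  pose h x := z x - zbar x.
  (* This coefficient of [t ^+ 2] bounds the remainder of the expansion: [K / 2] for the state term
     by stability, [alpha / 2] for the control term. *)
  apply: (@ge0_of_quadratic_ge0 _ _ ((K / 2 + alpha / 2) * L2_inner Omega h h)).
    by rewrite mulr_ge0// addr_ge0// divr_ge0// ltW.
  move=> t t0 t1.
  pose zt x := t * (z x - zbar x) + zbar x.
  have azt : admissible Omega a b zt by apply: admissible_convex => //; exact: ltW.
  have := opt _ azt; rewrite (expansion _ azt.1).
  have := KP f zt zbar df azt.1 Lzb.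
  have -> : (fun x => zt x - zbar x) = fun x => t * h x.
    by apply/funext => x; rewrite /zt /h addrK.
  have Lh : L2 Omega h by exact: (lin_closedB (sqint_lin_closed _ _ mO)).
  have [Vub _] := control_to_stateP n1 s0 s1 bO oO _ _ df Lzb.
  have [Vp _] := adjoint_stateP n1 s0 s1 bO oO _ _ Lud (tHs_L2 oO _ Vub).
  have Lg : L2 Omega (fun x => pbar x + alpha * zbar x).
    rewrite (_ : (fun _ => _) = fun x => alpha * zbar x + pbar x).
      by apply: (sqint_lin_closed _ _ mO).2 => //; exact: tHs_L2 oO _ Vp.
    by apply/funext => x; rewrite addrC.
  have th : L2_inner Omega (fun x => t * h x) (fun x => t * h x) =
      t ^+ 2 * L2_inner Omega h h.
    exact: psd_formZ (sqint_lin_closed _ _ mO) (inner_psd _ _ mO) t _ Lh.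
  have gth : L2_inner Omega (fun x => pbar x + alpha * zbar x) (fun x => t * h x) =
      t * L2_inner Omega (fun x => pbar x + alpha * zbar x) h.
    have := linear_onZ (sqint_lin_closed _ _ mO) _ t _ (inner_linear _ _ mO _ Lg) Lh.
    by rewrite /= inner_sym [X in _ = _ * X]inner_sym.
  rewrite th gth -addrA lerDl; lra.
(* The remainder is nonnegative whatever the size of [z - zbar], so the first-order condition
   already gives a global minimum. *)
- split=> // z az; rewrite (expansion _ az.1) -addrA lerDl addr_ge0 ?VI//.
  by rewrite addr_ge0// mulr_ge0// ?divr_ge0// ltW.
Qed.
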